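(* Let $\Lambda=\{\lambda_1,\lambda_2,\dots\}$ be a countably infinite set of (pairwise distinct) reals that is linearly independent over $\mathbb{Q}$. For $j=1,2,\dots$ let $$F_j(t):=e^{i\lambda_{2j-1}t}+e^{i\lambda_{2j}t}-1,\qquad t\in\mathbb{R}.$$ Then $F_j\in\mathrm{AP}$ for every $j$, and every complex subalgebra $A$ of $\mathrm{AP}$ containing the constant function $1$ and all the functions $F_j$ $(j\ge 1)$ has infinite Bass stable rank. Moreover, for every such $A$ and every integer $N\ge 1$, the tuple $(F_1,\dots,F_N)$ cannot be approximated in the supremum norm by tuples invertible in $A$; that is, $(F_1,\dots,F_N)$ is not in the closure of $U_N(A)$ with respect to the supremum norm.
   Context: $\mathrm{AP}$ is the uniform closure, in the algebra $C_b(\mathbb{R},\mathbb{C})$ of bounded continuous functions with the supremum norm and pointwise operations, of the set of generalized trigonometric polynomials $Q(t)=\sum_{j=1}^n a_j e^{i\mu_j t}$ with $a_j\in\mathbb{C}$, $\mu_j\in\mathbb{R}$, $n\ge 1$. The subalgebra $A$ is not assumed to be closed. For a commutative unital ring $A$, an $n$-tuple $(f_1,\dots,f_n)\in A^n$ is invertible if there is $(x_1,\dots,x_n)\in A^n$ with $\sum_{j=1}^n x_jf_j=1$; $U_n(A)$ is the set of invertible $n$-tuples. A tuple $(f_1,\dots,f_n,g)\in U_{n+1}(A)$ is reducible if there is $(a_1,\dots,a_n)\in A^n$ with $(f_1+a_1g,\dots,f_n+a_ng)\in U_n(A)$. The Bass stable rank of $A$ is the smallest integer $n\ge1$ such that every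 element of $U_{n+1}(A)$ is reducible, and is infinite if no such $n$ exists. *)

(* Defs.v *)
From HB Require Import structures.
From mathcomp Require Import all_boot all_order all_algebra.
From mathcomp Require Import complex.
From mathcomp Require Import all_classical all_reals all_analysis.

Set Implicit Arguments.
Unset Strict Implicit.
Unset Printing Implicit Defensive.

Import Order.TTheory GRing.Theory Num.Theory numFieldNormedType.Exports.

Local Open Scope classical_set_scope.
Local Open Scope ring_scope.

Section BassStableRank.
Variable B : comPzRingType.

(* The ring under study is a subring A of the ambient commutative ring B, given
   as a set of elements of B; coefficients are always taken in A. *)
Implicit Types (A : set B) (n : nat).

Definition invertible_tuples A n : set ('I_n -> B) :=
  [set f | (forall j, A (f j)) /\
     exists x : 'I_n -> B, (forall j, A (x j)) /\ \sum_(j < n) x j * f j = 1].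

(* h stands for (f_1, ..., f_n, g), with g = h ord_max. *)
Definition reducible A n (h : 'I_n.+1 -> B) : Prop :=
  exists a : 'I_n -> B, (forall j, A (a j)) /\
    invertible_tuples A
      (fun j : 'I_n => h (widen_ord (leqnSn n) j) + a j * h ord_max).

Definition bass_stable A n : Prop :=
  (1 <= n)%N /\
  forall h : 'I_n.+1 -> B, invertible_tuples A h -> reducible A h.

Definition bass_stable_rank A : \bar nat :=
  if pselect (exists n, `[< bass_stable A n >]) is left ex
  then (ex_minn ex)%:E else +oo%E.

End BassStableRank.

Section AlmostPeriodic.
Variable R : realType.
Implicit Types (f g : R -> R[i]) (A S : set (R -> R[i])).

Definition expi (x : R) : R[i] := (cos x +i* sin x)%C.

(* R[i]^o is R[i] with its usual topology and norm. *)
Definition bounded_continuous : set (R -> R[i]) :=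
  [set f | continuous (f : R -> R[i]^o) /\ bounded_fun (f : R -> R[i]^o)].

(* The real-valued modulus is normc; the supremum is taken in the
   extended reals, so that no junk value arises for unbounded functions. *)
Definition sup_norm f : \bar R :=
  ereal_sup (range (fun t => (Normc.normc (f t))%:E)).

Definition sup_closure S : set (R -> R[i]) :=
  [set f | forall e : R, 0 < e ->
     exists g, S g /\ (sup_norm (f - g)%R < e%:E)%E].

Definition tuple_sup_closure n (S : set ('I_n -> R -> R[i])) :
    set ('I_n -> R -> R[i]) :=
  [set u | forall e : R, 0 < e ->
     exists v, S v /\ forall j, (sup_norm (u j - v j)%R < e%:E)%E].

Definition trig_poly : set (R -> R[i]) :=
  [set Q | exists n (a : 'I_n -> R[i]) (mu : 'I_n -> R),
     (1 <= n)%N /\ Q = fun t => \sum_(j < n) a j * expi (mu j * t)].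

Definition AP : set (R -> R[i]) := bounded_continuous `&` sup_closure trig_poly.

(* Closedness under the pointwise operations. R -> R[i] has no canonical
   lalgType structure, hence no use of GRing.subalg_closed; the unit is not
   required here. *)
Definition complex_subalgebra A : Prop :=
  [/\ A 0,
      forall f g, A f -> A g -> A (f + g),
      forall (c : R[i]) f, A f -> A (fun t => c * f t) &
      forall f g, A f -> A g -> A (f * g)].

Definition rat_linearly_independent (lam : nat -> R) : Prop :=
  forall (n : nat) (q : nat -> rat),
    \sum_(k < n) ratr (q k) * lam k = 0 -> forall k, (k < n)%N -> q k = 0.

(* Indices start at 0: lam k is the (k+1)-st frequency, so the pairs
   (2j - 1, 2j), j >= 1, become (2j, 2j + 1), j >= 0. *)
Definition F (lam : nat -> R) (j : nat) : R -> R[i] :=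
  fun t => expi (lam j.*2 * t) + expi (lam j.*2.+1 * t) - 1.

End AlmostPeriodic.

Arguments bounded_continuous {R}.
Arguments trig_poly {R}.
Arguments AP {R}.

(* Main.v *)
(** The characters of the real line carried by the frequencies occurring in
finitely many trigonometric polynomials are dense (Kronecker) among the maps
[mu |-> expi (phi mu)] with [phi] additive, so every inequality between
trigonometric polynomials that holds on the real line survives when [mu * t] is
replaced by [phi mu]. As the frequencies [lam k] are independent over the
rationals, [phi (lam k)] can be prescribed freely, and hence there is a cube
of additive maps, of real dimension [2 N], on which [F_1, ..., F_N] restrict to
[Z_p = 2 cos gamma_p expi psi_p - 1] and [F_(N+1), ..., F_(2N)] to the complex
conjugates of the [Z_p].

The map [Z] satisfies the boundary conditions of the Poincare-Miranda theorem
with a margin, so every small perturbation of it vanishes somewhere in the cube;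
tuples that are invertible in [A] are bounded away from [0], which gives the
statement on the closure of [U_N(A)]. For the stable rank, put
[g = sum_p F_p F_(N+p) - 1/16]. Then [(F_1, ..., F_N, g)] is invertible, and [g]
restricts to [|Z|^2 - 1/16], which is nonnegative on the boundary of the cube. If
the [F_p + a_p g] were the entries of an invertible tuple, then [Z_p + a_p min(0, g)]
would have no zero in the cube and agree with [Z] on its boundary, contradicting
Poincare-Miranda again.

The Poincare-Miranda theorem itself is derived from its discrete version: for
labels [l_i] modulo 2 on a cubical grid, subdivided into the simplices
indexed by a base point and a permutation, the sum over all simplices of
the cup product of the coboundaries of the [l_i] depends only on the boundary
values of the [l_i], and equals [1] when [l_i] is [0] on the [i]-th lower face
and [1] on the [i]-th upper face. *)
Require Import Defs.
From HB Require Import structures.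
From mathcomp Require Import all_boot all_order all_algebra all_fingroup.
From mathcomp Require Import complex.
From mathcomp Require Import all_classical all_reals all_analysis.
From mathcomp Require Import zify ring lra.
Import Order.TTheory GRing.Theory Num.Theory numFieldNormedType.Exports.
Local Open Scope classical_set_scope.
Local Open Scope ring_scope.

Set Implicit Arguments.
Unset Strict Implicit.
Unset Printing Implicit Defensive.

#[local] Arguments Normc.normc : simpl never.

(** * Discrete Poincare-Miranda theorem *)

(** Additivity of a product in a single factor. It serves both to telescope edges and to exchange
    one label at a time. *)
Lemma prod_eq_off (A : comPzRingType) (I : finType) (P : pred I) (i0 : I)
    (X Y Z : I -> A) :
  P i0 -> (forall i, P i -> i != i0 -> X i = Z i /\ Y i = Z i) ->
  Z i0 = X i0 + Y i0 ->
  \prod_(i | P i) Z i = \prod_(i | P i) X i + \prod_(i | P i) Y i.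
Proof.
move=> Pi0 XYZ Zi0; rewrite !(bigD1 i0 Pi0) /= Zi0 mulrDl.
by congr (_ * _ + _ * _); apply: eq_bigr => i /andP[Pi ii0];
  case: (XYZ i Pi ii0).
Qed.

Lemma addrr_F2 (x : 'F_2) : x + x = 0.
Proof. exact: (addrr_pchar2 (pchar_Fp (isT : prime 2))). Qed.

Lemma oppr_F2 (x : 'F_2) : - x = x.
Proof. exact: (oppr_pchar2 (pchar_Fp (isT : prime 2))). Qed.

Section DiscretePoincareMiranda.
Variable n : nat.
Local Notation point := ('I_n.+1 -> nat).
Implicit Types (f : 'I_n.+1 -> point -> 'F_2) (p : 'I_n.+1) (x : point)
  (r : 'S_n.+1) (u v : nat -> point).

(** Kuhn triangulation of the unit cell at [x]: on the way from [x] to the opposite corner, the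
    coordinate [c] is raised at step [r c], counted from 0. *)
Definition vertex x r (j : nat) : point := fun c => (x c + (r c < j))%N.

Definition cup f v : 'F_2 := \prod_(i < n.+1) (f i (v i.+1) - f i (v i)).

(** A cochain of degree one less than [cup]: the factor at [p] uses no edge, so the later factors
    move to the edges from [i.-1] to [i]. *)
Definition cup_but f p u : 'F_2 :=
  \prod_(i < n.+1 | (i < p)%N) (f i (u i.+1) - f i (u i)) * f p (u p) *
  \prod_(i < n.+1 | (p < i)%N) (f i (u i) - f i (u i.-1)).

Section Coboundary.
Variables (f : 'I_n.+1 -> point -> 'F_2) (p : 'I_n.+1) (v : nat -> point).

Let d (i : 'I_n.+1) (m : nat) : 'F_2 := f i (v m.+1) - f i (v m).
(** The map [bump j] skips the vertex [j]. The edge of that face which jumps over [v j] is the sum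
    of the two edges at [v j], so its product is the sum of two consecutive [L] or of two
    consecutive [C]: the faces telescope modulo 2. *)
Let L (j : nat) := \prod_(i < n.+1 | (i < p)%N) d i (bump j i).
Let C (j : nat) := \prod_(i < n.+1 | (p < i)%N) d i (bump j i.-1).
Let W (j : nat) := cup_but f p (fun i => v (bump j i)).

Let C_p : C p = \prod_(i < n.+1 | (p < i)%N) d i i.
Proof.
apply: eq_bigr => i pi; congr d.
by rewrite /bump (_ : (p <= i.-1)%N = true); lia.
Qed.

Let L_p : L p = \prod_(i < n.+1 | (i < p)%N) d i i.
Proof. by apply: eq_bigr => i pi; congr d; rewrite /bump; lia. Qed.

Let W_low j : (j <= p)%N ->
  W j = \prod_(i < n.+1 | (i < p)%N)
          (f i (v (bump j i.+1)) - f i (v (bump j i))) *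
        (f p (v p.+1) * C p).
Proof.
move=> jp; rewrite C_p /W /cup_but -mulrA; congr (_ * (f p (v _) * _)).
  by rewrite /bump; lia.
by apply: eq_bigr => i pi; congr (f i (v _) - f i (v _)); rewrite /bump; lia.
Qed.

Let W_high j : (p < j)%N ->
  W j = L p * f p (v p) * \prod_(i < n.+1 | (p < i)%N)
          (f i (v (bump j i)) - f i (v (bump j i.-1))).
Proof.
move=> pj; rewrite L_p /W /cup_but; congr (_ * f p (v _) * _).
  by apply: eq_bigr => i pi; congr (f i (v _) - f i (v _)); rewrite /bump; lia.
by rewrite /bump; lia.
Qed.

Let sum_low m : (m <= p)%N ->
  \sum_(0 <= j < m.+1) W j = L m * (f p (v p.+1) * C p).
Proof.
elim: m => [_|m IH mp].
  by rewrite big_nat1 W_low //; congr (_ * _); apply: eq_bigr.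
rewrite big_nat_recr //= (IH (ltnW mp)) W_low //.
have ltm : (m < n.+1)%N by have := ltn_ord p; lia.
rewrite (@prod_eq_off _ _ _ (Ordinal ltm) (fun i => d i (bump m i))
  (fun i => d i (bump m.+1 i))) //.
- by rewrite mulrDl addrA -mulrDl addrr_F2 mul0r add0r.
- move=> i _ /eqP im; have {}im : (i : nat) <> m by move=> e; apply/im/val_inj.
  by split; congr (f i (v _) - f i (v _)); rewrite /bump; lia.
- rewrite /=; have -> : bump m.+1 m.+1 = m.+2 by rewrite /bump; lia.
  have -> : bump m.+1 m = m by rewrite /bump; lia.
  have -> : bump m m = m.+1 by rewrite /bump; lia.
  by rewrite /d addrA subrK.
Qed.

Let sum_mid m : (m <= n)%N -> (p <= m)%N ->
  \sum_(p.+1 <= j < m.+1) W j = L p * f p (v p) * (C m + C p).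
Proof.
elim: m => [_|m IH mn].
  by rewrite leqn0 => /eqP ->; rewrite big_geq // addrr_F2 mulr0.
rewrite leq_eqVlt => /orP[/eqP ->|].
  by rewrite big_geq // addrr_F2 mulr0.
rewrite ltnS => pm; rewrite big_nat_recr ?ltnS //= (IH (ltnW mn) pm) W_high //.
have ltm : (m.+1 < n.+1)%N by lia.
rewrite (@prod_eq_off _ _ _ (Ordinal ltm) (fun i => d i (bump m i.-1))
  (fun i => d i (bump m.+1 i.-1))) //.
- rewrite -mulrDr (addrC (C m)) addrACA addrCA.
  by rewrite -/(C m) -/(C m.+1) addrA (addrC (C p)) addrAC addrACA addrr_F2 add0r.
- move=> i pi /eqP im; have {}im : (i : nat) <> m.+1 by move=> e; apply/im/val_inj.
  by split; congr (f i (v _) - f i (v _)); rewrite /bump; lia.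
- rewrite /=; have -> : bump m.+1 m.+1 = m.+2 by rewrite /bump; lia.
  have -> : bump m.+1 m = m by rewrite /bump; lia.
  have -> : bump m m = m.+1 by rewrite /bump; lia.
  by rewrite /d addrA subrK.
Qed.

Let sum_high : \sum_(p.+1 <= j < n.+2) W j = L p * f p (v p) * C p.
Proof.
have pn : (p <= n)%N by rewrite -ltnS.
rewrite big_nat_recr ?ltnS //= sum_mid // W_high ?ltnS //.
(* On the last face no edge jumps over the omitted vertex; its term [C n] cancels the one left by
   the telescoping. *)
rewrite [X in _ + _ * X](_ : _ = C n).
  by rewrite -mulrDr addrAC addrr_F2 add0r.
apply: eq_bigr => i pi.
by congr (f i (v _) - f i (v _)); have := ltn_ord i; rewrite /bump; lia.
Qed.

(* Leibniz rule modulo 2 for [df_0 u ... u f_p u ... u df_n], whose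
   coboundary is [df_0 u ... u df_n]. *)
Lemma coboundary_cup_but :
  \sum_(j < n.+2) cup_but f p (fun i => v (bump j i)) = cup f v.
Proof.
rewrite -(big_mkord xpredT W) (@big_cat_nat _ _ _ p.+1) //=; last first.
  by rewrite ltnS ltnW.
rewrite sum_low // sum_high mulrA -mulrDl -mulrDr.
have -> : f p (v p.+1) + f p (v p) = d p p by rewrite /d oppr_F2.
rewrite (mulrC (L p)) C_p L_p /cup [RHS](bigD1 p) //= -mulrA; congr (_ * _).
rewrite [RHS](bigID (fun i : 'I_n.+1 => (i < p)%N)) /=; congr (_ * _).
  by apply: eq_bigl => i; rewrite -val_eqE /=; lia.
by apply: eq_bigl => i; rewrite -val_eqE /=; lia.
Qed.

End Coboundary.

(** * Degree modulo 2 of a labelled grid *)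

Variable k : nat.

Definition degree f : 'F_2 :=
  \sum_(x : {ffun 'I_n.+1 -> 'I_k.+1}) \sum_r cup f (vertex (fun c => x c) r).

Definition in_grid x : Prop := forall c, (x c <= k.+1)%N.

(** Skipping the intermediate vertex [j.+1] forgets the order of the two coordinates raised around
    it. Their transposition exchanges even and odd permutations and preserves the face, so these
    faces cancel in pairs. *)
Lemma sum_swap_vertex f p x (j : nat) : (j < n)%N ->
  \sum_r cup_but f p (fun i => vertex x r (bump j.+1 i)) = 0.
Proof.
move=> jn; have j0 : (j < n.+1)%N by lia.
pose t := tperm (Ordinal j0) (Ordinal (jn : (j.+1 < n.+1)%N)).
have fix_t r i : vertex x (r * t)%g (bump j.+1 i) = vertex x r (bump j.+1 i).
  apply/funext => c; rewrite /vertex permM; congr (_ + nat_of_bool _)%N.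
  rewrite /t; case: tpermP => [->|->|//] /=; rewrite /bump; lia.
rewrite (bigID (@odd_perm _)) /= [X in X + _](_ : _ =
    \sum_(r | ~~ odd_perm r) cup_but f p (fun i => vertex x r (bump j.+1 i))).
  exact: addrr_F2.
rewrite (reindex_inj (mulIg t)) /=; apply: eq_big => r.
  rewrite odd_permM odd_tperm -val_eqE /=.
  by rewrite (_ : (j != j.+1) = true) ?addbT //; lia.
by move=> _; congr cup_but; apply/funext => i; rewrite fix_t.
Qed.

(** A cyclic shift of the coordinate [c] turns one sum into the other. It wraps around only where
    [x c = k]; there the two terms lie on opposite faces of the grid and both vanish. *)
Lemma sum_shift_coord (H : point -> 'F_2) (c : 'I_n.+1) :
  (forall x, (forall c', c' != c -> (x c' <= k)%N) ->
     x c = 0%N \/ x c = k.+1 -> H x = 0) ->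
  \sum_(x : {ffun 'I_n.+1 -> 'I_k.+1}) H (fun c' => x c' + (c' == c))%N =
  \sum_(x : {ffun 'I_n.+1 -> 'I_k.+1}) H (fun c' => x c').
Proof.
move=> H0; pose sh (x : {ffun 'I_n.+1 -> 'I_k.+1}) : {ffun 'I_n.+1 -> 'I_k.+1} :=
  [ffun c' => if c' == c then ordS (x c') else x c'].
have sh_inj : injective sh.
  move=> x y /ffunP exy; apply/ffunP => c'; have := exy c'; rewrite !ffunE.
  by case: eqP => // _; exact: ordS_inj.
rewrite [RHS](reindex_inj sh_inj); apply: eq_bigr => x _.
have [xc|xc] := eqVneq (x c : nat) k.
  rewrite !H0 //.
  - by move=> c' ne; rewrite -ltnS ltn_ord.
  - by left; rewrite ffunE eqxx /= xc modnn.
  - by move=> c' /negPf ->; rewrite addn0 -ltnS ltn_ord.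
  - by right; rewrite eqxx xc addn1.
congr H; apply/funext => c'; rewrite ffunE; case: eqP => [->|_] /=; last by rewrite addn0.
by rewrite addn1 modn_small // ltnS ltn_neqAle xc -ltnS ltn_ord.
Qed.

Definition shift_perm : 'S_n.+1 := perm (@ordS_inj n.+1).

(** A face opposite to the last vertex is also the face opposite to the first vertex of a simplex in
    a neighbouring cell: the coordinate raised last in one is raised first in the other. *)
Lemma vertex_shift x r j : (j <= n)%N ->
  vertex (fun c => x c + (c == r^-1%g ord_max))%N r j =
  vertex x (r * shift_perm)%g j.+1.
Proof.
move=> jn; apply/funext => c; rewrite /vertex /= permM [shift_perm _]permE.
have -> : (c == r^-1%g ord_max) = (r c == ord_max).
  by apply/eqP/eqP => [->|<-]; rewrite ?permKV ?permK.
have [->|ne] := eqVneq (r c) ord_max => /=.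
  by rewrite modnn ltn0Sn; lia.
rewrite modn_small; last first.
  by have := ltn_ord (r c); move: ne; rewrite -val_eqE /=; lia.
by rewrite addn0 ltnS.
Qed.

Lemma cup_but_ext f p u v : (forall j, (j <= n)%N -> u j = v j) ->
  cup_but f p u = cup_but f p v.
Proof.
move=> uv; have le_n (i : 'I_n.+1) : (i <= n)%N by rewrite -ltnS.
rewrite /cup_but uv //; congr (_ * _ * _); apply: eq_bigr => i ip.
  by rewrite !uv //; have := le_n p; lia.
by rewrite !uv //; have := le_n i; lia.
Qed.

Definition const_on_faces (f : 'I_n.+1 -> point -> 'F_2) : Prop :=
  forall i x y, in_grid x -> in_grid y -> x i = y i ->
    x i = 0%N \/ x i = k.+1 -> f i x = f i y.

(** Stokes modulo 2: [cup f] is the coboundary of [cup_but f p], and interior faces cancel. On a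
    boundary face orthogonal to [c], the factor at [c] is a difference of equal labels if [c != p],
    and it vanishes by the hypothesis on [f p] if [c = p]. *)
Lemma degree_eq0 f p : const_on_faces f ->
  (forall x, in_grid x -> x p = 0%N \/ x p = k.+1 -> f p x = 0) ->
  degree f = 0.
Proof.
move=> fi fp; pose H r x := cup_but f p (vertex x r).
have HE r x : H r (fun c => x c + (c == r^-1%g ord_max))%N =
    cup_but f p (fun i => vertex x (r * shift_perm)%g (bump 0 i)).
  by apply: cup_but_ext => j jn; rewrite vertex_shift.
have H0 r x : (forall c', c' != r^-1%g ord_max -> (x c' <= k)%N) ->
    x (r^-1%g ord_max) = 0%N \/ x (r^-1%g ord_max) = k.+1 -> H r x = 0.
  set c := r^-1%g ord_max => xg xc.
  have vc j : (j <= n)%N -> vertex x r j c = x c.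
    by move=> jn; rewrite /vertex permKV /= ltnNge jn addn0.
  have vg j : (j <= n)%N -> in_grid (vertex x r j).
    move=> jn c'; have [->|ne] := eqVneq c' c.
      by rewrite vc //; case: xc => ->.
    by rewrite /vertex; have := xg c' ne; case: (_ < _)%N => /=; lia.
  have vc0 j : (j <= n)%N -> vertex x r j c = 0%N \/ vertex x r j c = k.+1.
    by move=> jn; rewrite vc.
  have le_n (i : 'I_n.+1) : (i <= n)%N by rewrite -ltnS.
  have face i j : (i <= n)%N -> (j <= n)%N ->
      f c (vertex x r i) - f c (vertex x r j) = 0.
    move=> iN jN; apply/eqP; rewrite subr_eq0; apply/eqP; apply: fi; auto.
    by rewrite !vc.
  rewrite /H /cup_but; have [cp|pc|/val_inj cp] := ltngtP c p.
  - by rewrite (bigD1 c) //= face ?mul0r // (leq_trans cp).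
  - by rewrite [X in _ * X](bigD1 c) //= face ?mul0r ?mulr0 // (leq_trans (leq_pred _)).
  - by rewrite [f p _]fp ?mulr0 ?mul0r -?cp //; auto.
have stokes x r : cup f (vertex x r) =
    cup_but f p (fun i => vertex x r (bump 0 i)) +
    (\sum_(j < n) cup_but f p (fun i => vertex x r (bump j.+1 i)) + H r x).
  rewrite -(coboundary_cup_but f p) big_ord_recl big_ord_recr /=.
  congr (_ + (_ + _)); apply: cup_but_ext => j jn; congr vertex.
  by rewrite /bump leqNgt ltnS jn.
rewrite /degree.
under eq_bigr => x _.
  under eq_bigr do rewrite stokes.
  rewrite !big_split /= (reindex_inj (mulIg shift_perm)) /=.
  under eq_bigr do rewrite -HE.
  rewrite [X in _ + (X + _)]exchange_big [X in _ + (X + _)]big1; last first.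
    by move=> j _; exact: sum_swap_vertex.
  rewrite add0r -big_split /=.
over.
rewrite exchange_big big1 //= => r _.
rewrite big_split /= (sum_shift_coord (H0 r)).
exact: addrr_F2.
Qed.

Definition coord_label (i : 'I_n.+1) (x : point) : 'F_2 := (x i != 0%N)%:R.

(** Only the simplex at the origin with the identity permutation contributes; in any other, some
    coordinate label is constant along its own edge. *)
Lemma degree_coord : degree coord_label = 1.
Proof.
have coordE x r i j : coord_label i (vertex x r j) = ((x i != 0%N) || (r i < j)%N)%:R.
  by rewrite /coord_label /vertex addn_eq0 negb_and; case: (_ < _)%N.
rewrite /degree (bigD1 [ffun=> ord0]) //= [X in _ + X]big1 => [|x x0].
  rewrite addr0 (bigD1 1%g) //= [X in _ + X]big1 => [|r r1].
    rewrite addr0 /cup big1 // => i _.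
    by rewrite !coordE ffunE perm1 /= ltnn ltnSn subr0.
  have [i ri] : exists i, r i != i.
    apply/existsP; apply: contraNT r1; rewrite negb_exists => /forallP ri.
    by apply/eqP/permP => i; rewrite perm1; apply/eqP; rewrite -[_ == _]negbK.
  rewrite /cup (bigD1 i) //= !coordE ffunE /= ltnS leq_eqVlt.
  by rewrite (negPf (ri : (r i : nat) != i)) subrr mul0r.
have [i xi] : exists i, (x i : nat) != 0%N.
  apply/existsP; apply: contraNT x0; rewrite negb_exists => /forallP xi.
  by apply/eqP/ffunP => i; rewrite ffunE; apply/val_inj; apply/eqP; have := xi i; rewrite negbK.
apply: big1 => r _; rewrite /cup (bigD1 i) //= !coordE xi.
by rewrite subrr mul0r.
Qed.

(** The labels are replaced by the coordinate labels one at a time. The change of degree is the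
    degree of a family whose label at the replaced index vanishes on both of its faces, hence 0. *)
Lemma degree_boundary f :
  (forall i x, in_grid x -> x i = 0%N -> f i x = 0) ->
  (forall i x, in_grid x -> x i = k.+1 -> f i x = 1) -> degree f = 1.
Proof.
move=> f0 f1; rewrite -degree_coord.
pose hyb (m : nat) (i : 'I_n.+1) := if (i < m)%N then coord_label i else f i.
have hyb0 m i x : in_grid x -> x i = 0%N -> hyb m i x = 0.
  by move=> xg xi; rewrite /hyb; case: ifP; rewrite ?f0 // /coord_label xi.
have hyb1 m i x : in_grid x -> x i = k.+1 -> hyb m i x = 1.
  by move=> xg xi; rewrite /hyb; case: ifP; rewrite ?f1 // /coord_label xi.
have step m : (m < n.+1)%N -> degree (hyb m) = degree (hyb m.+1).
  move=> mn; pose o := Ordinal mn.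
  pose g i x := if i == o then f i x - coord_label i x else hyb m i x.
  suff g0 : degree g = 0.
    rewrite -[RHS]add0r -g0 /degree -big_split; apply: eq_bigr => x _.
    rewrite -big_split; apply: eq_bigr => r _; apply: (prod_eq_off (i0 := o)) => //.
      move=> i _ io; rewrite /g (negPf io); split => //; rewrite /hyb.
      suff -> : (i < m.+1)%N = (i < m)%N by [].
      by rewrite ltnS leq_eqVlt (negPf (io : (i : nat) != m)).
    by rewrite /g eqxx /hyb /= ltnn ltnSn; ring.
  apply: (@degree_eq0 _ o) => [i x y xg yg xy xi|x xg xo]; rewrite /g ?eqxx.
    case: eqP => [io|_].
      rewrite /coord_label xy; congr (_ - _).
      by case: xi => e; [rewrite !f0 // -xy|rewrite !f1 // -xy].
    by case: xi => e; [rewrite !hyb0 // -xy|rewrite !hyb1 // -xy].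
  by case: xo => e; [rewrite f0|rewrite f1]; rewrite // /coord_label e subrr.
have hybE m : (m <= n.+1)%N -> degree f = degree (hyb m).
  elim: m => [_|m IH mn]; last by rewrite -step // IH // ltnW.
  by congr degree; apply/funext => i; apply/funext => x.
rewrite (hybE n.+1) //; congr degree; apply/funext => i; apply/funext => x.
by rewrite /hyb ltn_ord.
Qed.

Lemma discrete_poincare_miranda (l : 'I_n.+1 -> point -> bool) :
  (forall i x, in_grid x -> x i = 0%N -> l i x = false) ->
  (forall i x, in_grid x -> x i = k.+1 -> l i x = true) ->
  exists (x : point) (u v : 'I_n.+1 -> point), [/\ forall c, (x c <= k)%N,
    forall i c, (x c <= u i c <= (x c).+1)%N,
    forall i c, (x c <= v i c <= (x c).+1)%N &
    forall i : 'I_n.+1, l i (u i) = false /\ l i (v i) = true].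
Proof.
move=> l0 l1; pose f i x : 'F_2 := (l i x)%:R.
have /eqP : degree f != 0.
  rewrite (@degree_boundary f) ?oner_eq0 // /f => i x xg xi; first by rewrite l0.
  by rewrite l1.
apply: contra_notP => nex; rewrite /degree big1 // => x _; rewrite big1 // => r _.
(* A nonzero product means that, in this simplex, every [l i] changes along the edge from vertex [i]
   to vertex [i.+1]. *)
apply/eqP/negPn/negP; rewrite prodf_seq_neq0 => /allP cup0; apply: nex.
have li (i : 'I_n.+1) : l i (vertex (fun c => x c) r i) != l i (vertex (fun c => x c) r i.+1).
  have /= := cup0 i (mem_index_enum i).
  by apply: contra => /eqP e; rewrite /f e subrr.
have vx (j : nat) c : (x c <= vertex (fun c => x c) r j c <= (x c).+1)%N.
  by rewrite /vertex; case: (_ < _)%N; rewrite ?addn0 ?addn1 leqnn ?leqnSn.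
pose V (j : nat) := vertex (fun c => x c) r j.
exists (fun c => x c : nat), (fun i => V (if l i (V i) then i.+1 else i : nat)),
  (fun i => V (if l i (V i) then i : nat else i.+1)).
split=> [c|i c|i c|i] //; first by rewrite -ltnS.
move: (li i); rewrite -/(V i) -/(V i.+1).
by case Vi: (l i (V i)) => /=; case Vi1: (l i (V i.+1)); rewrite ?Vi ?Vi1.
Qed.

End DiscretePoincareMiranda.

(** * Poincare-Miranda theorem *)

Section PoincareMiranda.
Variables (R : realType) (n : nat).
Local Notation V := 'rV[R]_n.+1.

Definition grid_point (k : nat) (v : 'I_n.+1 -> nat) : V :=
  \row_c (2 * (v c)%:R / k.+1%:R - 1).

Lemma grid_point_close k (x u : 'I_n.+1 -> nat) :
  (forall c, (x c <= u c <= (x c).+1)%N) ->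
  forall c, `|grid_point k u 0 c - grid_point k x 0 c| <= 2 / k.+1%:R.
Proof.
move=> xu c; rewrite !mxE opprB addrA subrK -mulrBl -mulrBr normrM normfV.
rewrite normrM (ger0_norm (ler0n R 2)) (ger0_norm (ler0n R k.+1)) ler_pM2r ?invr_gt0 //.
rewrite -[leRHS]mulr1 ler_pM2l //; have /andP[xuc ucx] := xu c.
by rewrite -natrB // normr_nat lern1; lia.
Qed.

Definition in_cube (x : V) : Prop := forall j, -1 <= x 0 j <= 1.

Lemma grid_point_in_cube k (v : 'I_n.+1 -> nat) :
  (forall c, (v c <= k.+1)%N) -> in_cube (grid_point k v).
Proof.
move=> vk c; rewrite mxE lerBrDr addNr lerBlDr divr_ge0 ?mulr_ge0 //=.
by rewrite ler_pdivrMr // ler_pM2l // ler_nat.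
Qed.

Lemma compact_cube : compact in_cube.
Proof.
rewrite (_ : in_cube = [set v : V | forall i, `[-1, 1]%classic (v ord0 i)]).
  by apply: (@rV_compact R _ (fun=> `[-1, 1]%classic)) => i; exact: segment_compact.
by apply/seteqP; split => v vc i; have := vc i; rewrite /= in_itv.
Qed.

(** Sign labels on a grid of mesh [2 / k.+1] give a cell where every [f i] takes both signs; at a
    cluster point of such cells continuity excludes either strict sign. *)
Theorem poincare_miranda (f : 'I_n.+1 -> V -> R) :
  (forall i, continuous (f i)) ->
  (forall i x, in_cube x -> x 0 i = -1 -> f i x < 0) ->
  (forall i x, in_cube x -> x 0 i = 1 -> 0 < f i x) ->
  exists x, in_cube x /\ forall i, f i x = 0.
Proof.
move=> fcont fneg fpos.
have /choice[y yP] (k : nat) : exists y : V, in_cube y /\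
    forall i, exists a b : V, [/\ forall c, `|a 0 c - y 0 c| <= 2 / k.+1%:R,
      forall c, `|b 0 c - y 0 c| <= 2 / k.+1%:R, f i a <= 0 & 0 <= f i b].
  have [||x [u [v [xk xu xv uv]]]] :=
      @discrete_poincare_miranda n k (fun i x => 0 < f i (grid_point k x)).
  - move=> i x xg xi; apply/negbTE; rewrite -leNgt ltW // fneg //.
      exact: grid_point_in_cube.
    by rewrite mxE xi mulr0 mul0r sub0r.
  - move=> i x xg xi; rewrite fpos //; first exact: grid_point_in_cube.
    by rewrite mxE xi mulfK ?pnatr_eq0 //; ring.
  exists (grid_point k x); split.
    by apply: grid_point_in_cube => c; rewrite ltnW // ltnS.
  move=> i; exists (grid_point k (u i)), (grid_point k (v i)); split.
  - exact: grid_point_close.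
  - exact: grid_point_close.
  - by rewrite leNgt (uv i).1.
  - by rewrite ltW // (uv i).2.
have [x [xc xcl]] : in_cube `&` cluster (y @ \oo) !=set0.
  by apply: compact_cube; exists 0%N => // k _; exact: (yP k).1.
exists x; split=> // i.
have approx e : 0 < e -> exists a b : V, [/\ ball x e a, ball x e b, f i a <= 0 & 0 <= f i b].
  move=> e0; have e20 : 0 < e / 2 by rewrite divr_gt0.
  (* A bound [e / 4] on the inverse of [k.+1] makes the mesh [2 / k.+1] smaller than [e / 2]. *)
  have e40 : 0 < e / 4 by rewrite divr_gt0.
  have [N _ Nsmall] := near_infty_natSinv_lt (PosNum e40).
  have [_ [[k Nk <-] [_ xyk]]] := xcl [set y k | k in [set k | (N <= k)%N]] (ball x (e / 2))
    ltac:(by exists N => // k; exists k) (nbhsx_ballx x _ e20).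
  have [a [b [ay byk fa fb]]] := (yP k).2 i.
  have close (z : V) : (forall c, `|z 0 c - y k 0 c| <= 2 / k.+1%:R) -> ball x e z.
    move=> zy; split=> // c0 c; rewrite (ord1 c0); have := xyk 0 c.
    rewrite -!ball_normE /= => xy; rewrite -(subrKA (y k 0 c)).
    apply: (le_lt_trans (ler_normD _ _)); rewrite [ltRHS](splitr e) ltr_leD //.
    rewrite distrC (le_trans (zy c)) //.
    by have /= := Nsmall k Nk; set t := _^-1 => tk; lra.
  by exists a, b; split=> //; exact: close.
apply/eqP; rewrite eq_le; apply/andP; split; rewrite leNgt; apply/negP => fx.
  have /nbhs_ballP[e /= e0 eP] : \forall z \near x, 0 < f i z.
    exact: (cvgr_gt _ (fcont i x)).
  by have [a [b [/eP /= fa _ ]]] := approx e e0; rewrite leNgt fa.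
have /nbhs_ballP[e /= e0 eP] : \forall z \near x, f i z < 0.
  exact: (cvgr_lt _ (fcont i x)).
by have [a [b [_ /eP /= fb _ ]]] := approx e e0; rewrite leNgt fb.
Qed.

End PoincareMiranda.

(** * Kronecker's theorem *)

(** Cauchy-Schwarz for the sizes [c b] of the fibres of [h], obtained by expanding the squares
    [(K * c b - T) ^+ 2]. *)
Lemma card_collisions (A B : finType) (h : A -> B) :
  (#|A| ^ 2 <= #|B| * #|[pred aa : A * A | h aa.1 == h aa.2]|)%N.
Proof.
pose c b : rat := #|[pred a | h a == b]|%:R.
have cA : \sum_b c b = #|A|%:R.
  rewrite -natr_sum -sum1_card (partition_big h xpredT) //=; congr _%:R.
  by apply: eq_bigr => b _; rewrite -sum1_card; apply: eq_bigl => a; rewrite inE.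
have cAA : \sum_b c b ^+ 2 = #|[pred aa : A * A | h aa.1 == h aa.2]|%:R.
  rewrite -[in RHS]sum1_card natr_sum.
  rewrite (partition_big (fun aa : A * A => h aa.1) xpredT) //=.
  apply: eq_bigr => b _; rewrite /c -sum1_card natr_sum expr2 big_distrlr /=.
  rewrite pair_big /=; apply: eq_big => [[a a']|[a a'] _]; rewrite ?mulr1 //= !inE /=.
  by case: (h a =P b) => [->|]; rewrite ?andbF // andbT eq_sym.
have [B0|B0] := posnP #|B|.
  have [->|/card_gt0P[a _]] := posnP #|A|; first by [].
  by have := max_card (pred1 (h a)); rewrite card1 B0.
rewrite -(ler_nat rat) natrX natrM -cA -cAA; set T := \sum_b c b.
set K : rat := #|B|%:R; have K0 : 0 < K by rewrite ltr0n.
have : 0 <= \sum_b (K * c b - T) ^+ 2 by apply: sumr_ge0 => b _; exact: sqr_ge0.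
rewrite (eq_bigr (fun b => K ^+ 2 * c b ^+ 2 + (- (2 * K * T) * c b + T ^+ 2)));
  last by move=> b _; ring.
rewrite !big_split /= sumr_const -!mulr_sumr -/T -[T ^+ 2 *+ _]mulr_natl -/K.
set Q := \sum_b _; rewrite (_ : _ + _ = K * (K * Q - T ^+ 2)); last by ring.
by rewrite pmulr_rge0 // subr_ge0.
Qed.

Section Expi.
Variable R : realType.
Implicit Types x y t : R.
Local Notation normc := (@Normc.normc R).

Lemma expiD x y : expi (x + y) = expi x * expi y.
Proof.
by rewrite /expi cosD sinD [X in (_ +i* X)%C]addrC.
Qed.

Lemma expi0 : expi (0 : R) = 1.
Proof. by rewrite /expi cos0 sin0. Qed.

Lemma normc_expi x : normc (expi x) = 1.
Proof. by rewrite /Normc.normc /= cos2Dsin2 sqrtr1. Qed.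

Lemma expi_sum (I : Type) (r : seq I) (F : I -> R) :
  expi (\sum_(i <- r) F i) = \prod_(i <- r) expi (F i).
Proof. exact: (big_morph _ expiD expi0). Qed.

Lemma normcX (z : R[i]) n : normc (z ^+ n) = normc z ^+ n.
Proof.
by elim: n => [|n IH]; rewrite ?expr0 ?Normc.normc1 // !exprS Normc.normcM IH.
Qed.

Lemma normc_ge0 (z : R[i]) : 0 <= normc z.
Proof. by case: z => a b; exact: sqrtr_ge0. Qed.

Lemma normc_sum_le (I : Type) (r : seq I) (P : pred I) (F : I -> R[i]) :
  normc (\sum_(i <- r | P i) F i) <= \sum_(i <- r | P i) normc (F i).
Proof.
elim/big_rec2: _ => [|i y x _ le_yx]; first by rewrite Normc.normc0.
by apply: le_trans (le_normcD _ _) _; rewrite lerD2l.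
Qed.

Lemma sqr_normc_expi_sum (T : finType) (th : T -> R) :
  normc (\sum_i expi (th i)) ^+ 2 = \sum_(ij : T * T) cos (th ij.1 - th ij.2).
Proof.
have -> : \sum_i expi (th i) = ((\sum_i cos (th i)) +i* (\sum_i sin (th i)))%C.
  elim: (index_enum T) => [|i r IH]; first by rewrite !big_nil.
  by rewrite !big_cons IH.
rewrite /Normc.normc /= sqr_sqrtr ?addr_ge0 ?sqr_ge0 // !expr2 !big_distrlr /=.
rewrite -big_split /=.
under eq_bigr do rewrite -big_split /=.
by rewrite pair_big /=; apply: eq_bigr => -[i j] _; rewrite cosB.
Qed.

Lemma sqr_normc_addr1_expi x :
  normc (1 + expi x) ^+ 2 = 4 - normc (expi x - 1) ^+ 2.
Proof.
rewrite /Normc.normc /= !sqr_sqrtr ?addr_ge0 ?sqr_ge0 // oppr0 !addr0 add0r.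
by have := cos2Dsin2 x; move: (cos x) (sin x) => c s; nra.
Qed.

(** Multiplication by [2 * sin (x / 2)] telescopes the sum to a difference of two sines. *)
Lemma sum_cos_arith n x y : sin (x / 2) != 0 ->
  `|\sum_(k < n) cos (x * k%:R - y)| <= `|sin (x / 2)|^-1.
Proof.
move=> s0; set h := x / 2.
have tele : (\sum_(k < n) cos (x * k%:R - y)) * (2 * sin h) =
    sin (x * n%:R - h - y) - sin (- h - y).
  elim: n => [|n IH]; first by rewrite big_ord0 mul0r mulr0 sub0r subrr.
  rewrite big_ord_recr mulrDl IH /=.
  have -> : x * n.+1%:R - h - y = (x * n%:R - y) + h.
    by rewrite -natr1 mulrDr mulr1; have := splitr x; rewrite -/h; lra.
  have -> : x * n%:R - h - y = (x * n%:R - y) - h by lra.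
  by rewrite (sinD (_ - y) h) (sinB (_ - y) h); ring.
rewrite -[leRHS]mul1r ler_pdivlMr ?normr_gt0 // -normrM.
rewrite -(ler_pM2l (ltr0n R 2)) mulr1 -[X in X * _](@ger0_norm _ 2) //.
rewrite -normrM mulrCA tele (le_trans (ler_normB _ _)) //.
by rewrite (_ : 2 = 1 + 1) // lerD // sin_max.
Qed.

(* The mean of a finite sum of cosines is bounded by its supremum; the
   average is taken along an arithmetic progression [k * tau] so fine that no
   nonzero frequency resonates with it. *)
Lemma card_zero_freq_le (T : finType) (nu psi : T -> R) (C : R) :
  (forall i, nu i = 0 -> psi i = 0) ->
  (forall t, \sum_i cos (nu i * t - psi i) <= C) ->
  #|[pred i | nu i == 0]|%:R <= C.
Proof.
(* This choice gives [|nu i| * tau <= 1], so [sin (nu i * tau / 2)] is nonzero whenever [nu i]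
   is. *)
move=> psi0 le_C; pose tau := (1 + \sum_i `|nu i|)^-1.
have sge0 : 0 <= \sum_i `|nu i| by apply: sumr_ge0.
have tau0 : 0 < tau by rewrite invr_gt0 ltr_pwDl.
have sin_neq0 i : nu i != 0 -> sin (nu i * tau / 2) != 0.
  move=> nui; have nui0 : 0 < `|nu i| by rewrite normr_gt0.
  have : 0 < sin (`|nu i| * tau / 2).
    apply: sin2_gt0; rewrite divr_gt0 ?mulr_gt0 //=.
    rewrite ltr_pdivrMr // (@le_lt_trans _ _ 1) ?ltr_pMn //; last by lra.
    rewrite ler_pdivrMr ?mul1r ?ltr_pwDl // (bigD1 i) //= -[leLHS]addr0 addrCA.
    by rewrite lerD // addr_ge0 // sumr_ge0.
  case: (ltrgt0P (nu i)) => [?|?|/eqP]; rewrite ?(negPf nui) //.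
    by move=> /lt0r_neq0.
  by rewrite !mulNr sinN oppr_gt0 => /ltr0_neq0.
(* A bound, independent of the number of sample points, for the contribution of the nonzero
   frequencies; it disappears in the mean. *)
pose B := \sum_(i | nu i != 0) `|sin (nu i * tau / 2)|^-1.
have bound n : #|[pred i | nu i == 0]|%:R * n%:R <= C * n%:R + B.
  have : \sum_(k < n) \sum_i cos (nu i * (tau * k%:R) - psi i) <= C * n%:R.
    rewrite mulr_natr; apply: le_trans (_ : \sum_(k < n) C <= _).
      by apply: ler_sum.
    by rewrite sumr_const card_ord.
  rewrite exchange_big /= (bigID [pred i | nu i == 0]) /=.
  rewrite (eq_bigr (fun=> n%:R)) => [|i /eqP nui]; last first.
    rewrite (eq_bigr (fun=> 1)) ?sumr_const ?card_ord // => k _.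
    by rewrite nui mul0r psi0 // subrr cos0.
  rewrite sumr_const -[X in X + _]mulr_natl -lerBrDr => /le_trans; apply.
  rewrite lerBlDr -addrA lerDl -lerBlDr sub0r.
  rewrite /B -sumrN; apply: ler_sum => i nui.
  apply: le_trans (sum_cos_arith n (psi i) (sin_neq0 i nui)).
  rewrite -normrN (le_trans _ (ler_norm _)) // lerN2 le_eqVlt; apply/orP; left.
  by apply/eqP; apply: eq_bigr => k _; rewrite mulrA.
rewrite leNgt; apply/negP => Clt.
pose d : R := #|[pred i | nu i == 0]|%:R - C; have d0 : 0 < d by rewrite /d subr_gt0.
have B0 : 0 <= B by apply: sumr_ge0 => i _; rewrite invr_ge0.
have := archi_boundP (divr_ge0 B0 (ltW d0)); rewrite ltr_pdivrMr // => ltB.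
by have := bound (Num.bound (B / d)); rewrite -lerBlDl -mulrBl -/d leNgt mulrC ltB.
Qed.

Lemma poly_times_geometric_lt1 (M : nat) (q : R) : 0 <= q < 1 ->
  exists p : nat, (p.+1 ^ M)%:R * q ^+ p < 1.
Proof.
case/andP=> q0 q1; have [->|qn0] := eqVneq q 0.
  by exists 1%N; rewrite expr1 mulr0.
have {qn0}q0 : 0 < q by rewrite lt_neqAle eq_sym qn0.
pose g := q^-1 - 1; have g0 : 0 < g by rewrite subr_gt0 invf_gt1.
have bern (s : nat) : g * s%:R <= q ^- s.
  elim: s => [|s IH]; first by rewrite mulr0 invr_ge0 expr0.
  have ge1 : 1 <= q ^- s by rewrite -exprVn exprn_ege1 // ltW // invf_gt1.
  rewrite exprS invfM (_ : q^-1 = g + 1); last by rewrite subrK.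
  by rewrite -natr1; nra.
(* For [s > C], the bound [g * s <= q ^- s] raised to the power [M.+1] exceeds [(M.+2 * s) ^ M],
   which dominates [p.+1 ^ M] for [p = s * M.+1]. *)
pose C : R := ((M.+2) ^ M)%:R / g ^+ M.+1.
have C0 : 0 <= C by rewrite divr_ge0 // exprn_ge0 // ltW.
pose s := (Num.bound C).+1.
have sC : C < s%:R by rewrite (lt_trans (archi_boundP C0)) // ltr_nat.
exists (s * M.+1)%N.
rewrite exprM -[ltRHS](mulVf (lt0r_neq0 (exprn_gt0 M.+1 (exprn_gt0 s q0)))).
rewrite ltr_pM2r ?exprn_gt0 // -exprVn.
apply: lt_le_trans (_ : (g * s%:R) ^+ M.+1 <= _); last first.
  by rewrite lerXn2r ?nnegrE ?mulr_ge0 ?invr_ge0 ?exprn_ge0 // ltW.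
apply: le_lt_trans (_ : ((M.+2) ^ M)%:R * s%:R ^+ M < _).
  rewrite -natrX -natrM -expnMn ler_nat; have [->|M0] := posnP M; first by rewrite !expn0.
  rewrite leq_exp2r //; have s0 : (0 < s)%N by [].
  by move: (s) s0 M0 => s1 s0 M0; nia.
rewrite exprMn [s%:R ^+ M.+1]exprS mulrA ltr_pM2r ?exprn_gt0 ?ltr0n //.
by rewrite -ltr_pdivrMl ?exprn_gt0 // mulrC.
Qed.

(** If every [t] failed, the exponential sum, with the frequency 0 added, would have modulus at most
    [c < m.+1]. The mean of the [2 p]-th power of this modulus counts the coincidences [N f = N f'].
    As [N f] depends only on the multiplicities [h f], there are at least
    [m.+1 ^ (2 p) / p.+1 ^ m.+1] of them, too many for some [p]. *)
Theorem kronecker (phi : R -> R) (s : seq R) (e : R) :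
  {morph phi : x y / x + y} -> 0 < e ->
  exists t, forall mu, mu \in s -> normc (expi (mu * t) - expi (phi mu)) < e.
Proof.
move=> phiD e0.
have phi0 : phi 0 = 0 by apply: (addrI (phi 0)); rewrite -phiD !addr0.
have phiN x : phi (- x) = - phi x.
  by apply/eqP; rewrite -addr_eq0 -phiD addNr phi0.
apply: contrapT => nt.
pose m := size s; pose mu (j : 'I_m.+1) := nth 0 (0 :: s) j.
pose E j t := expi (mu j * t - phi (mu j)).
(* The frequency 0 contributes the term 1, and [|1 + z| <= 2 - e ^+ 2 / 4] when [|z| = 1] and
   [|z - 1| >= e]. *)
pose c : R := m.+1%:R - e ^+ 2 / 4.
have far t : exists2 j, j != ord0 & e <= normc (E j t - 1).
  apply: contrapT => nj; apply: nt; exists t => x xs; rewrite ltNge; apply/negP => le_e.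
  have xi : ((index x s).+1 < m.+1)%N by rewrite ltnS index_mem.
  apply: nj; exists (Ordinal xi) => //.
  rewrite /E (_ : mu (Ordinal xi) = x); last by rewrite /mu /= nth_index.
  apply: le_trans le_e _; rewrite -{1}(subrK (phi x) (x * t)) expiD.
  by rewrite -{2}(mul1r (expi (phi x))) -mulrBl Normc.normcM normc_expi mulr1.
pose M : R := m.+1%:R.
have M_sum (j : 'I_m.+1) : j != ord0 ->
    M = 1 + (1 + \sum_(i < m.+1 | (i != ord0) && (i != j)) 1).
  move=> j0; rewrite /M -{1}(card_ord m.+1) -sum1_card natr_sum.
  by rewrite (bigD1 ord0) // (bigD1 j).
have normc_le t : normc (\sum_j E j t) <= c.
  have [j j0 je] := far t.
  rewrite (bigD1 ord0) //= (bigD1 j) //= addrA.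
  rewrite (_ : E ord0 t = 1); last by rewrite /E mul0r phi0 subr0 expi0.
  apply: le_trans (le_normcD _ _) _.
  have h1 : normc (1 + E j t) <= 2 - e ^+ 2 / 4.
    have e2 : e ^+ 2 <= 4 - normc (1 + E j t) ^+ 2.
      by rewrite sqr_normc_addr1_expi subKr -/(E j t) lerXn2r ?nnegrE ?normc_ge0 // ltW.
    by have := sqr_ge0 (normc (1 + E j t) / 2 - 1); lra.
  apply: le_trans (lerD h1 (normc_sum_le _ _ _)) _.
  rewrite (eq_bigr (fun=> 1)) => [|i _]; last exact: normc_expi.
  by rewrite /c -/M (M_sum j j0) /=; lra.
have c0 : 0 <= c by apply: le_trans (normc_le 0); exact: normc_ge0.
have cM : c < M by rewrite /c -/M; have := exprn_gt0 2 e0; lra.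
have M0 : 0 < M by rewrite ltr0n.
have [|p] := @poly_times_geometric_lt1 m.+1 ((c / M) ^+ 2).
  have cM0 : 0 <= c / M by rewrite divr_ge0 // ltW.
  by rewrite sqr_ge0 expr_lt1 // ltr_pdivrMr // mul1r.
rewrite -exprM expr_div_n mulrA ltr_pdivrMr ?exprn_gt0 // mul1r ltNge => /negP; apply.
pose S := {ffun 'I_p -> 'I_m.+1}.
pose N (f : S) := \sum_i mu (f i).
have phi_sum (f : S) : phi (N f) = \sum_i phi (mu (f i)).
  exact: (big_morph _ phiD phi0).
have powE t : (\sum_j E j t) ^+ p = \sum_(f : S) expi (N f * t - phi (N f)).
  rewrite -[p in LHS]card_ord -prodr_const bigA_distr_bigA; apply: eq_bigr => f _.
  by rewrite -expi_sum phi_sum /N mulr_suml -sumrB.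
pose h (f : S) : {ffun 'I_m.+1 -> 'I_p.+1} := [ffun j => inord #|[pred i | f i == j]|].
have N_h (f : S) : N f = \sum_j mu j * (h f j)%:R.
  rewrite /N (partition_big f xpredT) //=; apply: eq_bigr => j _.
  rewrite (eq_bigr (fun=> mu j)) => [|i /eqP -> //].
  rewrite sumr_const mulr_natr ffunE inordK //.
  by rewrite ltnS -[X in (_ <= X)%N](card_ord p) max_card.
have le_c : #|[pred ff : S * S | N ff.1 - N ff.2 == 0]|%:R <= c ^+ (2 * p).
  apply: (@card_zero_freq_le _ _ (fun ff => phi (N ff.1 - N ff.2))) => [ff ->//|t].
  rewrite (eq_bigr (fun ff : S * S => cos ((N ff.1 * t - phi (N ff.1)) -
      (N ff.2 * t - phi (N ff.2))))) => [|ff _]; last by rewrite phiD phiN; congr cos; ring.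
  rewrite -(sqr_normc_expi_sum (fun f : S => N f * t - phi (N f))) -powE normcX.
  by rewrite mulnC exprM lerXn2r ?nnegrE ?exprn_ge0 ?normc_ge0 // lerXn2r ?nnegrE ?normc_ge0.
apply: le_trans (ler_wpM2l _ le_c) => //.
have := card_collisions h; rewrite !card_ffun !card_ord -(ler_nat R) natrX natrM.
rewrite natrX -exprM mulnC => /le_trans; apply.
rewrite ler_pM2l ?ltr0n ?expn_gt0 // ler_nat subset_leq_card //.
apply/fintype.subsetP => -[f f']; rewrite !inE /= => /eqP hh.
by rewrite !N_h hh subrr.
Qed.

End Expi.

(** * Rational coordinates *)

Section Coordinates.
Variable R : realType.

Definition rat_subspace (W : set R) : Prop :=
  W 0 /\ forall (q : rat) x y, W x -> W y -> W (ratr q * x + y).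

(** Zorn's lemma gives a rational subspace [A] maximal among those that contain the other [lam l]
    and avoid [lam k]. By maximality every real is congruent modulo [A] to a unique rational
    multiple of [lam k], whose coefficient is the coordinate. *)
Theorem rat_coordinate (lam : nat -> R) (k : nat) :
  rat_linearly_independent lam ->
  exists c : R -> R, {morph c : x y / x + y} /\
    forall l, c (lam l) = (l == k)%:R.
Proof.
move=> indep.
pose good (W : set R) :=
  [/\ rat_subspace W, forall l, l != k -> W (lam l) & ~ W (lam k)].
(* The equation is asked for all large [n], so that combinations of different lengths can be added
   termwise. *)
pose W0 : set R := [set x | exists (N : nat) (q : nat -> rat), q k = 0 /\
  forall n, (N <= n)%N -> x = \sum_(i < n) ratr (q i) * lam i].
have W0_good : good W0.
  split.
  - split; first by exists 0%N, (fun=> 0); split=> // n _; rewrite big1 // => i _; rewrite rmorph0 mul0r.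
    move=> q x y [N [u [uk xE]]] [M [v [vk yE]]].
    exists (maxn N M), (fun i => q * u i + v i); split; first by rewrite uk vk mulr0 addr0.
    move=> n; rewrite geq_max => /andP[Nn Mn]; rewrite (xE n Nn) (yE n Mn).
    rewrite mulr_sumr -big_split; apply: eq_bigr => i _ /=.
    by rewrite rmorphD rmorphM mulrDl mulrA.
  - move=> l lk; exists l.+1, (fun i => (i == l)%:R); split.
      by rewrite eq_sym (negPf lk).
    move=> n ln; rewrite (bigD1 (Ordinal ln)) //= eqxx rmorph1 mul1r big1 ?addr0 // => i il.
    by rewrite (negPf (il : (i : nat) != l)) rmorph0 mul0r.
  - move=> [N [q [qk kE]]]; pose n := maxn N k.+1.
    have kn : (k < n)%N by rewrite leq_maxr.
    have := indep n (fun i => q i - (i == k)%:R).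
    have -> : \sum_(i < n) ratr (q i - (nat_of_ord i == k)%:R) * lam i = 0.
      rewrite (eq_bigr (fun i : 'I_n => ratr (q i) * lam i -
        ratr (nat_of_ord i == k)%:R * lam i)) => [|i _]; last by rewrite rmorphB mulrBl.
      rewrite sumrB -kE ?leq_maxl // (bigD1 (Ordinal kn)) //= eqxx rmorph1 mul1r.
      rewrite big1 ?addr0 ?subrr // => i ik.
      by rewrite (negPf (ik : (i : nat) != k)) rmorph0 mul0r.
    by move=> /(_ erefl k kn)/eqP; rewrite qk eqxx sub0r oppr_eq0 oner_eq0.
have [F Fchain Ftot|A [A_good Amax]] :=
  @Zorn_bigcup R (fun W => W = set0 \/ good W).
  have [[W [FW W_n0]]|allempty] := pselect (exists W, F W /\ W !=set0); last first.
    left; apply/seteqP; split=> // x [W FW Wx].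
    by apply: allempty; exists W; split=> //; exists x.
  have goodF V : F V -> V !=set0 -> good V.
    by move=> FV [x Vx]; case: (Fchain V FV) => // V0; rewrite V0 in Vx.
  have [[Ws0 _] Wl Wk] := goodF W FW W_n0.
  right; split.
  - split; first by exists W.
    move=> q x y [U FU Ux] [V FV Vy].
    have [UV|VU] := Ftot U V FU FV.
      have [[_ VD] _ _] := goodF V FV (ex_intro _ y Vy).
      by exists V => //; apply: VD => //; exact: UV.
    have [[_ UD] _ _] := goodF U FU (ex_intro _ x Ux).
    by exists U => //; apply: UD => //; exact: VU.
  - by move=> l lk; exists W => //; exact: Wl.
  - by move=> [V FV Vk]; have [_ _] := goodF V FV (ex_intro _ _ Vk); apply.
have {}A_good : good A.
  case: A_good => // A0; exfalso; apply: (Amax W0); last by right.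
  by rewrite A0; split => //; have [[W00 _] _ _] := W0_good => /(_ 0 W00).
have [[A0 AD] Al Ak] := A_good.
have AB x y : A x -> A y -> A (x - y).
  by move=> Ax Ay; have := AD (- 1) y x Ay Ax; rewrite rmorphN1 mulN1r addrC.
have AZ q x : A x -> A (ratr q * x).
  by move=> Ax; have := AD q x 0 Ax A0; rewrite addr0.
have uniq (q r : rat) x : A (x - ratr q * lam k) -> A (x - ratr r * lam k) -> q = r.
  move=> Aq Ar; apply/eqP; rewrite -subr_eq0; apply/negP => /negP qr; apply: Ak.
  have := AB _ _ Ar Aq.
  rewrite (_ : x - _ - _ = ratr (q - r) * lam k); last by rewrite rmorphB; ring.
  by move=> /(AZ (q - r)^-1); rewrite mulrA -rmorphM mulVf // rmorph1 mul1r.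
have coord x : exists q : rat, A (x - ratr q * lam k).
  have [Ax|nAx] := pselect (A x); first by exists 0; rewrite rmorph0 mul0r subr0.
  (* The span of [A] and [x]. By maximality it contains [lam k], with a nonzero coefficient of [x],
     which can be solved for [x]. *)
  pose B := [set y | exists r : rat, A (y - ratr r * x)].
  have AB_sub : A `<=` B by move=> y Ay; exists 0; rewrite rmorph0 mul0r subr0.
  have Bx : B x by exists 1; rewrite rmorph1 mul1r subrr.
  have [r Br] : B (lam k).
    apply: contrapT => nBk; apply: (Amax B); first by split => // /(_ x Bx).
    right; split => //; last by move=> l lk; apply/AB_sub/Al.
    split; first exact: AB_sub.
    move=> q y z [u Au] [v Av]; exists (q * u + v).
    have := AD q _ _ Au Av; congr A; rewrite rmorphD rmorphM; ring.
  have r0 : r != 0.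
    by apply/eqP => r0; apply: Ak; move: Br; rewrite r0 rmorph0 mul0r subr0.
  exists r^-1; have := AZ (- r^-1) _ Br; congr A.
  have : ratr r != 0 :> R by rewrite fmorph_eq0.
  by rewrite rmorphN fmorphV => ?; field.
have /choice[c cP] := coord.
exists (fun x => ratr (c x)); split.
  move=> x y; rewrite -rmorphD; congr ratr; apply: (uniq _ _ (x + y)); first exact: cP.
  have := AD 1 _ _ (cP x) (cP y); congr A; rewrite rmorph1 rmorphD; ring.
move=> l; rewrite -(ratr_nat R); congr ratr; apply: (uniq _ _ (lam l)); first exact: cP.
have [->|lk] := eqVneq l k; first by rewrite rmorph1 mul1r subrr.
by rewrite rmorph0 mul0r subr0; exact: Al.
Qed.

End Coordinates.

(** * Limits of complex-valued functions *)

Section ComplexLimits.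
Variable R : realType.
Local Notation normc := (@Normc.normc R).
Local Notation C := (R[i]^o).

Lemma normc_ge_Re (z : R[i]) : `|complex.Re z| <= normc z.
Proof.
case: z => a b; rewrite /Normc.normc /= -sqrtr_sqr ler_wsqrtr // lerDl sqr_ge0 //.
Qed.

Lemma normc_ge_Im (z : R[i]) : `|complex.Im z| <= normc z.
Proof.
case: z => a b; rewrite /Normc.normc /= -sqrtr_sqr ler_wsqrtr // lerDr sqr_ge0 //.
Qed.

Lemma normc_le_ReIm (z : R[i]) : normc z <= `|complex.Re z| + `|complex.Im z|.
Proof.
case: z => a b; rewrite /Normc.normc /= -[leRHS]ger0_norm ?addr_ge0 //.
rewrite -sqrtr_sqr ler_wsqrtr // sqrrD !real_normK ?num_real // lerD2r lerDl mulrn_wge0 // mulr_ge0.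
Qed.

Lemma norm_normc (z : R[i]) : `|z| = (normc z)%:C%C.
Proof. by case: z => a b; rewrite normc_def. Qed.

(** The norm of [C] has values in [R[i]], where a positive element has zero imaginary part; hence
    real radii suffice. *)
Lemma cvg_normcP (T : Type) (F : set_system T) {FF : Filter F} (f : T -> R[i]) (l : R[i]) :
  (f x @[x --> F] --> (l : C)) <->
  (forall e : R, 0 < e -> \forall x \near F, normc (l - f x) < e).
Proof.
split=> [fl e e0|fl].
  have := @cvgr_dist_lt _ C _ F _ _ _ fl (e%:C)%C.
  rewrite ltcR => /(_ _ e0); apply: filterS => x.
  by rewrite norm_normc ltcR.
apply/(@cvgrPdist_lt _ C) => -[e e'] /=; rewrite ltcE /= => /andP[/eqP -> e0].
by have := fl e e0; apply: filterS => x; rewrite norm_normc ltcR.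
Qed.

Lemma cvg_complex (T : Type) (F : set_system T) {FF : Filter F} (f g : T -> R) (a b : R) :
  f x @[x --> F] --> a -> g x @[x --> F] --> b ->
  (f x +i* g x)%C @[x --> F] --> ((a +i* b)%C : C).
Proof.
move=> fa gb; apply/cvg_normcP => e e0; have e2 : 0 < e / 2 by rewrite divr_gt0.
near=> x; apply: le_lt_trans (normc_le_ReIm _) _; rewrite [ltRHS]splitr ltrD //=.
  by near: x; exact: cvgr_dist_lt.
by near: x; exact: cvgr_dist_lt.
Unshelve. all: by end_near. Qed.

Lemma lipschitz_normc_cvg (h : R[i] -> R) :
  (forall z w, `|h z - h w| <= normc (z - w)) ->
  forall (T : Type) (F : set_system T) (FF : Filter F) (f : T -> R[i]) (l : R[i]),
  f x @[x --> F] --> (l : C) -> h (f x) @[x --> F] --> h l.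
Proof.
move=> hl T F FF f l /cvg_normcP fl; apply/cvgrPdist_lt => e e0.
by have := fl e e0; apply: filterS => x; exact: le_lt_trans.
Qed.

Lemma ReB (z w : R[i]) : complex.Re (z - w) = complex.Re z - complex.Re w.
Proof. by case: z; case: w. Qed.

Lemma ImB (z w : R[i]) : complex.Im (z - w) = complex.Im z - complex.Im w.
Proof. by case: z; case: w. Qed.

Lemma normc_dist (z w : R[i]) : `|normc z - normc w| <= normc (z - w).
Proof.
have le (u v : R[i]) : normc u - normc v <= normc (u - v).
  by rewrite lerBlDr -{1}(subrK v u) le_normcD.
by rewrite ler_norml le andbT lerNl opprB -(normcN (z - w)) opprB le.
Qed.

Section Cvg.
Context (T : Type) (F : set_system T) {FF : Filter F}.

Lemma cvg_Re (f : T -> R[i]) (l : R[i]) : f x @[x --> F] --> (l : C) ->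
  complex.Re (f x) @[x --> F] --> complex.Re l.
Proof. by apply: lipschitz_normc_cvg => z w; rewrite -ReB normc_ge_Re. Qed.

Lemma cvg_Im (f : T -> R[i]) (l : R[i]) : f x @[x --> F] --> (l : C) ->
  complex.Im (f x) @[x --> F] --> complex.Im l.
Proof. by apply: lipschitz_normc_cvg => z w; rewrite -ImB normc_ge_Im. Qed.

Lemma cvg_normc (f : T -> R[i]) (l : R[i]) : f x @[x --> F] --> (l : C) ->
  normc (f x) @[x --> F] --> normc l.
Proof. exact: (lipschitz_normc_cvg normc_dist). Qed.

Lemma cvg_expi (f : T -> R) (l : R) : f x @[x --> F] --> l ->
  expi (f x) @[x --> F] --> (expi l : C).
Proof.
by move=> fl; apply: cvg_complex; apply: continuous_cvg fl;
  [exact: continuous_cos|exact: continuous_sin].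
Qed.

Lemma cvg_cstC (c : R[i]) : c @[_ --> F] --> (c : C).
Proof. exact: (@cvg_cst C c T F FF). Qed.

Lemma cvg_addC (f g : T -> R[i]) (a b : R[i]) : f x @[x --> F] --> (a : C) ->
  g x @[x --> F] --> (b : C) -> (f x + g x) @[x --> F] --> (a + b : C).
Proof. exact: (@cvgD _ C). Qed.

Lemma cvg_mulC (f g : T -> R[i]) (a b : R[i]) : f x @[x --> F] --> (a : C) ->
  g x @[x --> F] --> (b : C) -> (f x * g x) @[x --> F] --> (a * b : C).
Proof. exact: (@cvgM R[i]). Qed.

Lemma cvg_sumC (I : Type) (r : seq I) (f : I -> T -> R[i]) (a : I -> R[i]) :
  (forall i, f i x @[x --> F] --> (a i : C)) ->
  (\sum_(i <- r) f i x) @[x --> F] --> (\sum_(i <- r) a i : C).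
Proof.
by move=> fa; apply: (@cvg_big C _ +%R) => //; exact: add_continuous.
Qed.
End Cvg.

End ComplexLimits.
Arguments cvg_cstC {R T F FF} c.

(** * Almost periodic functions and Bohr limits *)

Section BohrLimits.
Variable R : realType.
Local Notation normc := (@Normc.normc R).
Local Notation C := (R[i]^o).
Implicit Types (phi : R -> R) (Q : R -> R[i]).

(* Neighbourhoods, in the Bohr compactification, of the character
   [mu |-> expi (phi mu)], traced on the real line. *)
Definition bohr_nbhs phi : set_system R :=
  [set U | exists (s : seq R) (e : R), 0 < e /\
     [set t | forall mu, mu \in s -> normc (expi (mu * t) - expi (phi mu)) < e] `<=` U].

(** Properness is Kronecker's theorem. Thanks to it, non-strict inequalities valid on the real line
    pass to limits along this filter. *)
Lemma bohr_nbhs_proper phi : {morph phi : x y / x + y} ->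
  ProperFilter (bohr_nbhs phi).
Proof.
move=> phiD; apply: Build_ProperFilter_ex.
  move=> U [s [e [e0 sU]]]; have [t tP] := kronecker s phiD e0.
  by exists t; exact: sU.
split.
- by exists [::], 1.
- move=> U V [s [d [d0 sU]]] [r [e [e0 rV]]].
  exists (s ++ r), (Num.min d e); split; first by rewrite lt_min d0.
  move=> t tP; split; [apply: sU|apply: rV] => mu mus.
    by have := tP mu; rewrite mem_cat mus lt_min => /(_ isT)/andP[].
  by have := tP mu; rewrite mem_cat mus orbT lt_min => /(_ isT)/andP[].
- by move=> U V UV [s [e [e0 sU]]]; exists s, e; split=> // t /sU/UV.
Qed.

Lemma bohr_nbhs_cvg phi : {morph phi : x y / x + y} -> forall mu : R,
  expi (mu * t) @[t --> bohr_nbhs phi] --> (expi (phi mu) : C).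
Proof.
move=> phiD mu; have FF := bohr_nbhs_proper phiD; apply/cvg_normcP => e e0.
exists [:: mu], e; split=> // t /(_ mu (mem_head _ _)).
by rewrite -normcN opprB.
Qed.

Arguments bohr_nbhs_cvg {phi} phiD mu.

(** The extension [L] of [Q] to characters replaces [mu * t] by [phi mu]. *)
Lemma trig_poly_lift Q : trig_poly Q -> exists L : (R -> R) -> R[i],
  (forall phi, {morph phi : x y / x + y} -> Q t @[t --> bohr_nbhs phi] --> (L phi : C)) /\
  (forall (T : topologicalType) (phi : T -> R -> R),
     (forall mu, continuous (phi ^~ mu)) ->
     continuous (fun x => L (phi x) : C)).
Proof.
move=> [n [a [mu [_ ->]]]].
exists (fun phi => \sum_(j < n) a j * expi (phi (mu j))); split.
  move=> phi phiD; have FF := bohr_nbhs_proper phiD.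
  by apply: cvg_sumC => j; exact: (cvg_mulC (cvg_cstC (a j)) (bohr_nbhs_cvg phiD (mu j))).
move=> T phi phic x; apply: cvg_sumC => j.
exact: (cvg_mulC (cvg_cstC (a j)) (cvg_expi (phic (mu j) x))).
Qed.

Lemma sup_norm_lt (f : R -> R[i]) (e : R) : (sup_norm f < e%:E)%E ->
  forall t, normc (f t) < e.
Proof.
move=> fe t; rewrite -lte_fin; apply: le_lt_trans fe.
by apply: ereal_sup_ubound; exists t.
Qed.

Lemma trig_poly_bounded Q : trig_poly Q ->
  exists B, 0 < B /\ forall t, normc (Q t) <= B.
Proof.
move=> [n [a [mu [_ ->]]]]; exists (1 + \sum_(j < n) normc (a j)); split.
  by rewrite ltr_pwDl // sumr_ge0 // => j _; exact: normc_ge0.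
move=> t; apply: le_trans (normc_sum_le _ _ _) _; rewrite -[leLHS]add0r lerD //.
by apply: ler_sum => j _; rewrite Normc.normcM normc_expi mulr1.
Qed.

Lemma AP_approx (f : R -> R[i]) (e : R) : AP f -> 0 < e ->
  exists2 Q, trig_poly Q & forall t, normc (f t - Q t) < e.
Proof.
move=> [_ fcl] e0; have [Q [QT fQ]] := fcl e e0.
by exists Q => // t; have := sup_norm_lt fQ t.
Qed.

Lemma AP_bounded (f : R -> R[i]) : AP f ->
  exists B, 0 < B /\ forall t, normc (f t) <= B.
Proof.
move=> fAP; have [Q QT fQ] := AP_approx fAP ltr01.
have [B [B0 QB]] := trig_poly_bounded QT; exists (1 + B); split.
  by rewrite addr_gt0.
move=> t; rewrite -[f t](subrK (Q t)); apply: le_trans (le_normcD _ _) _.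
by rewrite lerD // ltW.
Qed.

(** The coefficients of a Bezout identity are bounded by a common [S], as almost periodic functions
    are bounded; so the identity forces the moduli of the entries to sum to at least [S^-1]. *)
Lemma invertible_lower_bound (A : set (R -> R[i])) (n : nat)
    (f : 'I_n -> R -> R[i]) : A `<=` AP -> invertible_tuples A f ->
  exists d, 0 < d /\ forall t, d <= \sum_j normc (f j t).
Proof.
move=> AAP [_ [x [Ax xf1]]].
have /choice[B BP] j : exists B, 0 < B /\ forall t, normc (x j t) <= B.
  exact/AP_bounded/AAP.
pose S := 1 + \sum_j B j; have S0 : 0 < S.
  by rewrite ltr_pwDl // sumr_ge0 // => j _; rewrite ltW // (BP j).1.
exists S^-1; split; first by rewrite invr_gt0.
move=> t; rewrite -(ler_pM2l S0) mulfV ?gt_eqF // mulr_sumr.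
have -> : 1 = normc (\sum_j x j t * f j t).
  rewrite (_ : \sum_j _ = (1 : R -> R[i]) t) ?Normc.normc1 // -xf1.
  by rewrite fct_sumE.
apply: le_trans (normc_sum_le _ _ _) _; apply: ler_sum => j _.
rewrite Normc.normcM ler_wpM2r ?normc_ge0 // (le_trans ((BP j).2 t)) //.
rewrite /S (bigD1 j) //= addrCA lerDl addr_ge0 // sumr_ge0 // => i _.
by rewrite ltW // (BP i).1.
Qed.

Lemma F_trig_poly (lam : nat -> R) j : trig_poly (F lam j).
Proof.
exists 3%N, (fun k : 'I_3 => tnth [tuple 1; 1; -1] k),
  (fun k : 'I_3 => tnth [tuple lam j.*2; lam j.*2.+1; 0] k); split => //.
apply/funext => t; rewrite /F !big_ord_recl big_ord0 /tnth /= addr0 addrA.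
by rewrite !mul1r mul0r expi0 mulr1.
Qed.

Lemma trig_poly_AP Q : trig_poly Q -> AP Q.
Proof.
move=> QT; split; last first.
  move=> e e0; exists Q; split=> //; rewrite subrr.
  apply: (@le_lt_trans _ _ 0%E); last by rewrite lte_fin.
  by apply: ge_ereal_sup => _ [t _ <-]; rewrite Normc.normc0.
split; last first.
  have [B [B0 QB]] := trig_poly_bounded QT.
  exists (B%:C)%C; split; first by rewrite realE lecR ltW.
  move=> x Bx t _ /=; rewrite norm_normc; apply: le_trans (ltW Bx).
  by rewrite lecR.
case: QT => n [a [mu [_ ->]]] t; apply: cvg_sumC => j.
apply: (cvg_mulC (cvg_cstC (a j))); apply: cvg_expi.
by apply: cvgM; [exact: cvg_cst|exact: cvg_id].
Qed.

End BohrLimits.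
Arguments bohr_nbhs_cvg {R phi} phiD mu.

(** * A cube of characters *)

Section CharacterCube.
Variables (R : realType) (n : nat).
Local Notation normc := (@Normc.normc R).
Local Notation C := (R[i]^o).
Local Notation N := n.+1.
Local Notation V := 'rV[R]_(N + N).
Implicit Types (x : V) (p : 'I_N).

Lemma poincare_miranda_complex (f : 'I_N -> V -> R[i]) :
  (forall p, continuous (f p : V -> C)) ->
  (forall p x, in_cube x -> x 0 (lshift N p) = -1 -> complex.Re (f p x) < 0) ->
  (forall p x, in_cube x -> x 0 (lshift N p) = 1 -> 0 < complex.Re (f p x)) ->
  (forall p x, in_cube x -> x 0 (rshift N p) = -1 -> complex.Im (f p x) < 0) ->
  (forall p x, in_cube x -> x 0 (rshift N p) = 1 -> 0 < complex.Im (f p x)) ->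
  exists x, in_cube x /\ forall p, f p x = 0.
Proof.
move=> fc ReN Re1 ImN Im1.
pose g (i : 'I_(N + N)) x := match fintype.split i with
  inl p => complex.Re (f p x) | inr p => complex.Im (f p x) end.
have [||| x [xc gx]] := @poincare_miranda R (n + N) g.
- move=> i x; rewrite /g; case: fintype.split => p.
    exact: (cvg_Re (fc p x)).
  exact: (cvg_Im (fc p x)).
- by move=> i x xc; rewrite /g; case: split_ordP => p ->; [exact: ReN|exact: ImN].
- by move=> i x xc; rewrite /g; case: split_ordP => p ->; [exact: Re1|exact: Im1].
exists x; split=> // p; apply/eqP; rewrite eq_complex /=.
have := gx (lshift N p); rewrite /g; case: split_ordP => q /eqP;
  rewrite ?eq_lshift ?eq_lrshift // => /eqP <- ->.
have := gx (rshift N p); rewrite /g; case: split_ordP => r /eqP;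
  rewrite ?eq_rshift ?eq_rlshift // => /eqP <- ->.
by rewrite eqxx.
Qed.

(** As the coordinate grows from -1 to 1, [cos (gamma x p)] runs from 1/4 to 1, while
    [cos (psi x p)] stays at least 3/4. This leaves a margin 1/4 on every face; for the imaginary
    part it comes from [2 * (1 / 4) * (1 / 2)]. *)
Definition gamma x p : R := acos (1 / 4) * ((1 - x 0 (lshift N p)) / 2).
Definition psi x p : R := acos (3 / 4) * x 0 (rshift N p).

Lemma ler_cos (a b : R) : 0 <= a -> a <= b -> b <= pi -> cos b <= cos a.
Proof.
move=> a0 ab bpi; rewrite leNgt; apply/negP.
rewrite ltr_cos ?in_itv /= ?a0 ?(le_trans a0 ab) ?bpi ?(le_trans ab bpi) //.
by rewrite ltNge ab.
Qed.

Let g1 : -1 <= (1 / 4 : R) <= 1. Proof. by apply/andP; split; lra. Qed.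
Let p1 : -1 <= (3 / 4 : R) <= 1. Proof. by apply/andP; split; lra. Qed.

Lemma cos_gamma_ge x p : in_cube x -> 1 / 4 <= cos (gamma x p).
Proof.
move=> /(_ (lshift N p)); rewrite /gamma; move: (x 0 _) => a /andP[a1 a2].
rewrite -[leLHS]acosK ?in_itv //=; apply: ler_cos; last exact: acos_lepi.
  by rewrite mulr_ge0 ?acos_ge0 //; lra.
by rewrite ler_piMr ?acos_ge0 //; lra.
Qed.

Lemma cos_psi_ge x p : in_cube x -> 3 / 4 <= cos (psi x p).
Proof.
move=> /(_ (rshift N p)); rewrite /psi; move: (x 0 _) => b b1.
rewrite -[leLHS]acosK ?in_itv //= -[leRHS]cos_norm.
have b1' : `|b| <= 1 by rewrite ler_norml.
rewrite normrM (ger0_norm (acos_ge0 p1)).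
apply: ler_cos; last exact: acos_lepi.
  by rewrite mulr_ge0 ?acos_ge0.
by rewrite ler_piMr ?acos_ge0.
Qed.

Lemma sin_acos_ge : 1 / 2 <= sin (acos (3 / 4 : R)).
Proof.
rewrite sin_acos // -[leLHS]ger0_norm; last by lra.
rewrite -sqrtr_sqr ler_wsqrtr //; lra.
Qed.

Definition Zval x p : R[i] :=
  ((2 * cos (gamma x p) * cos (psi x p) - 1) +i*
   (2 * cos (gamma x p) * sin (psi x p)))%C.

Lemma Re_Zval_N1 x p : in_cube x -> x 0 (lshift N p) = -1 ->
  complex.Re (Zval x p) <= - (1 / 4).
Proof.
move=> xc xp; rewrite /Zval /= (_ : cos (gamma x p) = 1 / 4).
  by have := cos_le1 (psi x p); lra.
rewrite /gamma xp opprK (_ : (1 + 1) / 2 = 1); last by lra.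
by rewrite mulr1 acosK ?in_itv.
Qed.

Lemma Re_Zval_1 x p : in_cube x -> x 0 (lshift N p) = 1 ->
  1 / 4 <= complex.Re (Zval x p).
Proof.
move=> xc xp; rewrite /Zval /= (_ : cos (gamma x p) = 1).
  by have := cos_psi_ge p xc; lra.
by rewrite /gamma xp subrr mul0r mulr0 cos0.
Qed.

Lemma Im_Zval_N1 x p : in_cube x -> x 0 (rshift N p) = -1 ->
  complex.Im (Zval x p) <= - (1 / 4).
Proof.
move=> xc xp; rewrite /Zval /= /psi xp mulrN1 sinN.
have := sin_acos_ge; have := cos_gamma_ge p xc; nra.
Qed.

Lemma Im_Zval_1 x p : in_cube x -> x 0 (rshift N p) = 1 ->
  1 / 4 <= complex.Im (Zval x p).
Proof.
move=> xc xp; rewrite /Zval /= /psi xp mulr1.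
have := sin_acos_ge; have := cos_gamma_ge p xc; nra.
Qed.

Lemma Zval_expi x p :
  expi (psi x p + gamma x p) + expi (psi x p - gamma x p) - 1 = Zval x p.
Proof.
rewrite /expi /Zval cosD sinD cosB sinB; simpc; congr (_ +i* _)%C; ring.
Qed.

Lemma conj_Zval_expi x p :
  expi (- psi x p + gamma x p) + expi (- psi x p - gamma x p) - 1 = (Zval x p)^*%C.
Proof.
rewrite /expi /Zval cosD sinD cosB sinB cosN sinN; simpc; congr (_ +i* _)%C; ring.
Qed.

(* [gamma] and [psi] give coordinates on a square of the torus on which
   [expi a + expi b - 1 = 2 cos gamma expi psi - 1]; the frequencies of the
   second half of the functions [F] carry the complex conjugates. *)
Definition angle x (k : nat) : R :=
  let p : 'I_N := inord (k./2 %% N) in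
  (-1) ^+ (N <= k./2)%N * psi x p + (-1) ^+ odd k * gamma x p.

Lemma angle_low x p : angle x p.*2 = psi x p + gamma x p /\
  angle x p.*2.+1 = psi x p - gamma x p.
Proof.
rewrite /angle /= uphalf_double doubleK odd_double /=.
by rewrite modn_small // inord_val leqNgt ltn_ord !expr0 expr1 !mul1r mulN1r.
Qed.

Lemma angle_high x p : angle x (N + p).*2 = - psi x p + gamma x p /\
  angle x (N + p).*2.+1 = - psi x p - gamma x p.
Proof.
rewrite /angle /= uphalf_double doubleK odd_double /=.
by rewrite -addSn modnDl modn_small // inord_val leq_addr expr0 expr1 !mul1r !mulN1r.
Qed.

Lemma continuous_coord (i : 'I_(N + N)) : continuous (fun x => x 0 i).
Proof. exact: coord_continuous. Qed.

Lemma continuous_gamma p : continuous (gamma ^~ p).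
Proof.
move=> x; exact: (cvgM (cvg_cst _)
  (cvgM (cvgB (cvg_cst _) (@continuous_coord _ x)) (cvg_cst _))).
Qed.

Lemma continuous_psi p : continuous (psi ^~ p).
Proof. by move=> x; exact: (cvgM (cvg_cst _) (@continuous_coord _ x)). Qed.

Lemma continuous_angle k : continuous (angle ^~ k).
Proof.
move=> x; exact: (cvgD (cvgM (cvg_cst _) (@continuous_psi _ x))
  (cvgM (cvg_cst _) (@continuous_gamma _ x))).
Qed.

Lemma continuous_Zval p : continuous (Zval ^~ p : V -> C).
Proof.
move=> x; rewrite /continuous_at -Zval_expi; under eq_cvg do rewrite -Zval_expi.
have [psic gamc] := (@continuous_psi p x, @continuous_gamma p x).
exact: (cvg_addC (cvg_addC (cvg_expi (cvgD psic gamc)) (cvg_expi (cvgB psic gamc)))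
  (cvg_cstC (-1))).
Qed.

(** The additive maps [c k] are dual to the frequencies, so a combination of them takes the
    prescribed value [angle x l] at [lam l]. *)
Lemma bohr_family (lam : nat -> R) : rat_linearly_independent lam ->
  exists phi : V -> R -> R, [/\ forall x, {morph phi x : a b / a + b},
    forall mu, continuous (phi ^~ mu),
    forall x p, F lam p t @[t --> bohr_nbhs (phi x)] --> (Zval x p : C) &
    forall x p, F lam (N + p) t @[t --> bohr_nbhs (phi x)] --> ((Zval x p)^*%C : C)].
Proof.
move=> indep.
have /choice[c cP] k := rat_coordinate k indep.
pose phi x mu := \sum_(k < (N + N).*2) c k mu * angle x k.
have phi_lam x l : (l < (N + N).*2)%N -> phi x (lam l) = angle x l.
  move=> lN; rewrite /phi (bigD1 (Ordinal lN)) //= (cP l).2 eqxx mul1r.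
  rewrite big1 ?addr0 // => k kl.
  by rewrite (cP k).2 eq_sym (negPf (kl : (k : nat) != l)) mul0r.
have phiD x : {morph phi x : a b / a + b}.
  move=> a b; rewrite /phi -big_split; apply: eq_bigr => k _.
  by rewrite (cP k).1 mulrDl.
have F_cvg x (p : nat) : (p < N + N)%N -> F lam p t @[t --> bohr_nbhs (phi x)] -->
    (expi (angle x p.*2) + expi (angle x p.*2.+1) - 1 : C).
  move=> pN; have FF := bohr_nbhs_proper (phiD x).
  rewrite -!phi_lam ?ltn_double ?ltn_Sdouble //.
  exact: (cvg_addC (cvg_addC (bohr_nbhs_cvg (phiD x) _) (bohr_nbhs_cvg (phiD x) _))
    (cvg_cstC (-1))).
exists phi; split=> // [mu|x p|x p].
- apply: (@continuous_big R _ +%R) => [|k _ x]; first exact: add_continuous.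
  exact: (cvgM (cvg_cst _) (@continuous_angle k x)).
- have := F_cvg x p; rewrite (angle_low x p).1 (angle_low x p).2 Zval_expi; apply.
  by rewrite ltn_addr.
- have := F_cvg x (N + p)%N; rewrite (angle_high x p).1 (angle_high x p).2.
  by rewrite conj_Zval_expi; apply; rewrite ltn_add2l.
Qed.

End CharacterCube.

(** * Tuples near the functions F *)

Section NoZeros.
Variables (R : realType) (n : nat) (lam : nat -> R).
Hypothesis indep : rat_linearly_independent lam.
Local Notation normc := (@Normc.normc R).
Local Notation C := (R[i]^o).
Local Notation N := n.+1.
Local Notation V := 'rV[R]_(N + N).

Lemma cvg_sum_normc (T : Type) (G : set_system T) {FG : ProperFilter G}
    (f : 'I_N -> T -> R[i]) (l : 'I_N -> R[i]) (d : R) :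
  (forall j, f j x @[x --> G] --> (l j : C)) ->
  (forall x, d <= \sum_j normc (f j x)) -> d <= \sum_j normc (l j).
Proof.
move=> fl df.
have sl : (\sum_j normc (f j x)) @[x --> G] --> \sum_j normc (l j).
  by apply: (@cvg_big R _ +%R) => [|j _]; [exact: add_continuous|exact: cvg_normc].
exact: cvgr_to_ge sl (nearW _ df).
Qed.

Lemma sum_normc_approx (f g : 'I_N -> R[i]) (d : R) :
  d <= \sum_j normc (f j) -> (forall j, normc (f j - g j) <= d / 2 / N%:R) ->
  d / 2 <= \sum_j normc (g j).
Proof.
move=> df fg; rewrite -(lerD2l (d / 2)) -splitr; apply: (le_trans df).
have -> : d / 2 = \sum_(j < N) d / 2 / N%:R.
  by rewrite sumr_const card_ord -[RHS]mulr_natr divfK ?pnatr_eq0.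
rewrite -big_split; apply: ler_sum => j _.
by rewrite -[f j](subrK (g j)) (le_trans (le_normcD _ _)) // lerD2r.
Qed.

(** On the cube, the extensions of trigonometric approximants of the [v j] stay within 1/16 + 1/16
    of [Zval], less than the margin 1/4 on the faces. They therefore have a common zero, although a
    lower bound [d / 2] passes to the limit. *)
Lemma near_F_not_bounded_below (v : 'I_N -> R -> R[i]) (d : R) :
  0 < d -> (forall j, AP (v j)) -> (forall (j : 'I_N) t, normc (F lam j t - v j t) <= 1 / 16) ->
  ~ (forall t, d <= \sum_j normc (v j t)).
Proof.
move=> d0 vAP Fv vd; have dN0 : 0 < d / 2 / N%:R by rewrite !divr_gt0.
(* The first bound preserves the signs on the faces; the second, summed over [N] entries, costs at
   most half of [d]. *)
pose e := Num.min (1 / 16) (d / 2 / N%:R).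
have e0 : 0 < e by rewrite lt_min dN0 divr_gt0.
have /choice[Q QP] j : exists Q, trig_poly Q /\ forall t, normc (v j t - Q t) < e.
  by have [Q] := AP_approx (vAP j) e0; exists Q.
have /choice[L LP] j := trig_poly_lift (QP j).1.
have [phi [phiD phic Flo _]] := bohr_family n indep.
have close (j : 'I_N) x : normc (Zval x j - L j (phi x)) <= 1 / 8.
  have FF := bohr_nbhs_proper (phiD x).
  rewrite -mulN1r.
  have FQ : normc (F lam j t + -1 * Q j t) @[t --> bohr_nbhs (phi x)] -->
      normc (Zval x j + -1 * L j (phi x)).
    exact: (cvg_normc (cvg_addC (Flo x j)
      (cvg_mulC (cvg_cstC (-1)) ((LP j).1 _ (phiD x))))).
  apply: (cvgr_to_le FQ); apply: nearW => t.
  rewrite mulN1r -(subrK (v j t) (F lam j t)) -addrA (le_trans (le_normcD _ _)) //.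
  rewrite (_ : 1 / 8 = 1 / 16 + 1 / 16); last by lra.
  rewrite lerD ?Fv // ltW //.
  by have := (QP j).2 t; rewrite lt_min => /andP[].
have closeRe j x : `|complex.Re (Zval x j) - complex.Re (L j (phi x))| <= 1 / 8.
  by rewrite -ReB (le_trans (normc_ge_Re _)).
have closeIm j x : `|complex.Im (Zval x j) - complex.Im (L j (phi x))| <= 1 / 8.
  by rewrite -ImB (le_trans (normc_ge_Im _)).
have [||||| x [_ Lx0]] := @poincare_miranda_complex R n (fun j x => L j (phi x)).
- by move=> j; exact: (LP j).2.
- move=> p x xc xp; have := closeRe p x; have := Re_Zval_N1 xc xp.
  by rewrite ler_norml => ? /andP[]; lra.
- move=> p x xc xp; have := closeRe p x; have := Re_Zval_1 xc xp.
  by rewrite ler_norml => ? /andP[]; lra.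
- move=> p x xc xp; have := closeIm p x; have := Im_Zval_N1 xc xp.
  by rewrite ler_norml => ? /andP[]; lra.
- move=> p x xc xp; have := closeIm p x; have := Im_Zval_1 xc xp.
  by rewrite ler_norml => ? /andP[]; lra.
have FF := bohr_nbhs_proper (phiD x).
have : d / 2 <= \sum_j normc (L j (phi x)).
  apply: (@cvg_sum_normc _ _ FF Q) => [j|t]; first exact: (LP j).1.
  apply: (sum_normc_approx (vd t)) => j.
  by have := (QP j).2 t; rewrite lt_min => /andP[_ /ltW].
rewrite big1 => [|j _]; last by rewrite Lx0 Normc.normc0.
by rewrite leNgt divr_gt0.
Qed.

(** The constant 1/16 is the square of the margin 1/4 of [Zval] on the faces; as it is nonzero, the
    functions [F lam i] together with this one generate 1. *)
Definition bezout_rest (t : R) : R[i] :=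
  \sum_(i < N) F lam i t * F lam (N + i) t - ((1 / 16)%:C)%C.

Lemma mulCJ (z : R[i]) : z * z^*%C = ((normc z ^+ 2)%:C)%C.
Proof. by rewrite -sqr_normc norm_normc rmorphXn. Qed.

(* On the section of [bohr_family] the function [bezout_rest] becomes
   [sum |Z_p|^2 - 1/16], which is nonnegative on the boundary of the cube; there
   its negative part vanishes, hence the modified map equals [Z]. *)
Lemma F_add_rest_not_bounded_below (a : 'I_N -> R -> R[i]) (d : R) :
  0 < d -> (forall j, AP (a j)) ->
  ~ (forall t, d <= \sum_(j < N) normc (F lam j t + a j t * bezout_rest t)).
Proof.
move=> d0 aAP ad.
have /choice[B BP] j : exists B, 0 < B /\ forall t, normc (F lam j t) <= B.
  exact: trig_poly_bounded (F_trig_poly lam j).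
(* A bound for [bezout_rest], which multiplies the error made in replacing [a j] by [Q j]. *)
pose D := \sum_(i < N) B i * B (N + i)%N + 1 / 16.
have D0 : 0 < D.
  by rewrite ltr_wpDl ?divr_gt0 // sumr_ge0 // => i _; rewrite mulr_ge0 // ltW // (BP _).1.
have rest_le t : normc (bezout_rest t) <= D.
  apply: le_trans (le_normcD _ _) _; rewrite normcN lerD //.
    apply: le_trans (normc_sum_le _ _ _) _; apply: ler_sum => i _.
    by rewrite Normc.normcM ler_pM ?normc_ge0 // (BP _).2.
  by rewrite /Normc.normc /= expr0n addr0 sqrtr_sqr ger0_norm.
have e0 : 0 < d / 2 / N%:R / D by rewrite !divr_gt0.
have /choice[Q QP] j : exists Q, trig_poly Q /\
    forall t, normc (a j t - Q t) < d / 2 / N%:R / D.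
  by have [Q] := AP_approx (aAP j) e0; exists Q.
have /choice[L LP] j := trig_poly_lift (QP j).1.
have [phi [phiD phic Flo Fhi]] := bohr_family n indep.
have Qd t : d / 2 <= \sum_(j < N) normc (F lam j t + Q j t * bezout_rest t).
  apply: (sum_normc_approx (ad t)) => j.
  rewrite opprD addrACA subrr add0r -mulrBl Normc.normcM.
  by rewrite -[leRHS](divfK (lt0r_neq0 D0)) ler_pM ?normc_ge0 // ltW // (QP j).2.
pose w x : R := \sum_(i < N) normc (Zval x i) ^+ 2 - 1 / 16.
have restE x : \sum_(i < N) Zval x i * (Zval x i)^*%C - ((1 / 16)%:C)%C = ((w x)%:C)%C.
  by rewrite rmorphB rmorph_sum; congr (_ - _); apply: eq_bigr => i _; rewrite mulCJ.
have rest_cvg x : bezout_rest t @[t --> bohr_nbhs (phi x)] --> (((w x)%:C)%C : C).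
  have FF := bohr_nbhs_proper (phiD x).
  rewrite -restE; apply: cvg_addC (cvg_cstC _); apply: cvg_sumC => i.
  exact: cvg_mulC (Flo x i) (Fhi x i).
have lift_ge x : d / 2 <= \sum_(j < N) normc (Zval x j + L j (phi x) * ((w x)%:C)%C).
  have FF := bohr_nbhs_proper (phiD x).
  apply: (@cvg_sum_normc _ _ FF _ _ _ _ Qd) => j.
  exact: (cvg_addC (Flo x j) (cvg_mulC ((LP j).1 _ (phiD x)) (rest_cvg x))).
have wc : continuous w.
  have sc : continuous (fun x => \sum_(i < N) normc (Zval x i) ^+ 2).
    apply: (@continuous_big R _ +%R) => [|i _ x]; first exact: add_continuous.
    have nc : normc (Zval y i) @[y --> x] --> normc (Zval x i).
      exact: (cvg_normc (@continuous_Zval R n i x)).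
    exact: (cvgM nc nc).
  by move=> x; exact: (cvgB (sc x) (cvg_cst _)).
pose H (j : 'I_N) x := Zval x j + L j (phi x) * ((Num.min 0 (w x))%:C)%C.
have H_face j x : 1 / 4 <= normc (Zval x j) -> H j x = Zval x j.
  move=> Z4; rewrite /H min_l ?mulr0 ?addr0 // /w (bigD1 j) //= addrAC.
  rewrite addr_ge0 ?sumr_ge0 // => [|i _]; last by rewrite sqr_ge0.
  rewrite subr_ge0 (_ : 1 / 16 = (1 / 4) ^+ 2); last by lra.
  by rewrite lerXn2r ?nnegrE ?normc_ge0.
have [||||| x [_ Hx0]] := @poincare_miranda_complex R n H.
- move=> j x; apply: (cvg_addC (@continuous_Zval R n j x)).
  apply: (cvg_mulC ((LP j).2 _ phi phic x)).
  apply: cvg_complex; last exact: cvg_cst.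
  exact: (continuous_min (cvg_cst _) (wc x)).
- move=> p x xc xp; have Z := Re_Zval_N1 xc xp; rewrite H_face; first by lra.
  by apply: le_trans (normc_ge_Re _); rewrite ler_normr; apply/orP; right; lra.
- move=> p x xc xp; have Z := Re_Zval_1 xc xp; rewrite H_face; first by lra.
  by apply: le_trans (normc_ge_Re _); rewrite ler_normr Z.
- move=> p x xc xp; have Z := Im_Zval_N1 xc xp; rewrite H_face; first by lra.
  by apply: le_trans (normc_ge_Im _); rewrite ler_normr; apply/orP; right; lra.
- move=> p x xc xp; have Z := Im_Zval_1 xc xp; rewrite H_face; first by lra.
  by apply: le_trans (normc_ge_Im _); rewrite ler_normr Z.
(* At a zero of [H] with [w x >= 0], all [Zval x j] vanish and [w x = - 1 / 16], which is absurd; if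
   [w x < 0], then [H] is the map bounded below by [lift_ge]. *)
have [w0|w0] := lerP 0 (w x).
  have Z0 j : Zval x j = 0.
    by have := Hx0 j; rewrite /H min_l // mulr0 addr0.
  move: w0; rewrite /w big1 => [|i _]; last by rewrite Z0 Normc.normc0 expr0n.
  lra.
have := lift_ge x; rewrite big1 => [|j _].
  by rewrite leNgt divr_gt0.
by have := Hx0 j; rewrite /H min_r ?(ltW w0) // => ->; rewrite Normc.normc0.
Qed.

End NoZeros.

(** * Infinite stable rank and failure of approximation by invertible tuples *)

Section Main.
Variables (R : realType) (lam : nat -> R) (A : set (R -> R[i])).
Hypotheses (indep : rat_linearly_independent lam) (A_alg : complex_subalgebra A).
Hypotheses (A_AP : A `<=` AP) (A1 : A (cst 1)) (AF : forall j, A (F lam j)).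

Lemma subalgebra_cst (c : R[i]) : A (cst c).
Proof.
have [_ _ AZ _] := A_alg; have := AZ c _ A1; congr A.
by apply/funext => t; rewrite /= mulr1.
Qed.

Lemma bezout_rest_mem n : A (bezout_rest n lam).
Proof.
have [A0 AD _ AM] := A_alg.
rewrite (_ : bezout_rest n lam = \sum_(i < n.+1) F lam i * F lam (n.+1 + i)
  + cst (- ((1 / 16)%:C)%C)); last by apply/funext => t; rewrite /= fctE fct_sumE.
apply: (AD); last exact: subalgebra_cst.
by apply: big_ind => [//||i _]; [exact: AD|exact: AM].
Qed.

Lemma not_bass_stable n : ~ bass_stable A n.
Proof.
have [A0 AD _ AM] := A_alg.
case: n => [|n] [] // _ stable.
pose h (j : 'I_n.+2) := if (j < n.+1)%N then F lam j else bezout_rest n lam.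
have h_max : h ord_max = bezout_rest n lam.
  by rewrite /h /= ltnn.
have h_low (j : 'I_n.+1) : h (widen_ord (leqnSn n.+1) j) = F lam j.
  by rewrite /h /= ltn_ord.
have h_inv : invertible_tuples A h.
  split=> [j|]; first by rewrite /h; case: ifP => _ //; exact: bezout_rest_mem.
  (* Bezout identity [16 * (\sum_j F_j F_(N+j) - g) = 1] with [g = bezout_rest n lam] and
     [N = n.+1]: the second half of the functions supplies the coefficients. *)
  exists (fun j : 'I_n.+2 => if (j < n.+1)%N then cst 16 * F lam (n.+1 + j)
    else cst (- 16)); split=> [j|].
    by case: ifP => _; [apply: AM|]; rewrite ?AF //; exact: subalgebra_cst.
  rewrite big_ord_recr /= ltnn h_max; apply/funext => t.
  rewrite !fctE fct_sumE /bezout_rest mulrBr addrA mulr_sumr -big_split big1 => [|i _].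
    rewrite sub0r mulNr opprK -[16](rmorph_nat (real_complex R) 16) -rmorphM.
    by rewrite mul1r divff ?pnatr_eq0.
  rewrite ltn_ord h_low /= !fctE mulNr; apply/eqP; rewrite subr_eq0; apply/eqP; ring.
have [a [Aa /(invertible_lower_bound A_AP) [d [d0 dP]]]] := stable h h_inv.
apply: (@F_add_rest_not_bounded_below R n lam indep a d d0) => [j|t].
  exact/A_AP/Aa.
apply: (le_trans (dP t)); apply: ler_sum => j _.
by rewrite h_low h_max.
Qed.

(** An invertible tuple closer than 1/16 to the functions [F lam j] would be bounded away from 0,
    which [near_F_not_bounded_below] excludes. *)
Lemma not_tuple_sup_closure n : (1 <= n)%N ->
  ~ tuple_sup_closure (@invertible_tuples (R -> R[i]) A n)
      (fun j : 'I_n => F lam j).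
Proof.
case: n => // n _ /(_ (1 / 16)) [|v [v_inv Fv]]; first by rewrite divr_gt0.
have [d [d0 dP]] := invertible_lower_bound A_AP v_inv.
apply: (near_F_not_bounded_below indep d0 _ _ dP) => [j|j t].
  exact/A_AP/v_inv.1.
by have := sup_norm_lt (Fv j) t; move/ltW.
Qed.

End Main.

Theorem theorem5p1 (R : realType) (lam : nat -> R)
    (lam_inj : injective lam) (lam_indep : rat_linearly_independent lam) :
  (forall j : nat, AP (F lam j)) /\
  forall A : set (R -> R[i]),
    complex_subalgebra A -> A `<=` AP ->
    A (cst 1) -> (forall j : nat, A (F lam j)) ->
    bass_stable_rank A = +oo%E /\
    forall N : nat, (1 <= N)%N ->
      ~ tuple_sup_closure (@invertible_tuples (R -> R[i]) A N)
          (fun j : 'I_N => F lam j).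
Proof.
split=> [j|A A_alg A_AP A1 AF]; first exact/trig_poly_AP/F_trig_poly.
split=> [|N N1]; last exact: (not_tuple_sup_closure lam_indep A_AP).
rewrite /bass_stable_rank; case: pselect => // ex; have [n /asboolP stable] := ex.
by have := not_bass_stable lam_indep A_alg A_AP A1 AF stable.
Qed.
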